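(* Let $\Omega\subseteq\mathbb R^N$ be a bounded open set satisfying a uniform exterior sphere condition, $K\in L^\infty(\Omega\times B_1)$ with $\lambda\le K\le\Lambda$ on $\Omega\times B_1$ ($0<\lambda\le\Lambda$), and let $u\in L^\infty(B_1(\Omega))\cap C(\overline\Omega)\cap C^{Dini}_{loc}(\Omega)$ with $u=0$ in $B_1(\Omega)\setminus\Omega$ and $L_Ku\in L^\infty(\Omega)$. Then there are $\alpha=\alpha(\lambda,\Lambda,N,\Omega)\in(0,1)$ and $C=C(N,\lambda,\Lambda,\Omega)>0$ such that $u\in\mathcal L^\alpha(B_1(\Omega))$ and $$[u]_{\mathcal L^\alpha(B_1(\Omega))}\le C\|L_Ku\|_{L^\infty(\Omega)}.$$
   Context: $B_1(\Omega):=\bigcup_{x\in\Omega}B_1(x)$. $C^{Dini}_{loc}(\Omega)$: functions that on every closed ball in $\Omega$ admit a modulus of continuity $\omega$ with $\int_0^1\omega(\rho)\rho^{-1}d\rho<\infty$. $L_Ku(x):=\int_{B_1(x)}\frac{u(x)-u(y)}{|y-x|^N}K(x,y-x)\,dy$ for $x\in\Omega$. $\ell(\rho):=|\ln(\min\{\rho,1/10\})|^{-1}$ ($\rho>0$). $[u]_{\mathcal L^\alpha(U)}:=\sup_{x\ne y\in U}\frac{|u(x)-u(y)|}{\ell^\alpha(|x-y|)}$, and $\mathcal L^\alpha(U)$ is the space of $u$ with $\|u\|_{L^\infty(U)}+[u]_{\mathcal L^\alpha(U)}<\infty$. *)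

(* Defs.v *)
From HB Require Import structures.
From mathcomp Require Import all_boot all_order all_algebra.
From mathcomp Require Import all_classical all_reals all_analysis.
Set Implicit Arguments.
Unset Strict Implicit.
Unset Printing Implicit Defensive.
Import Order.TTheory GRing.Theory Num.Theory.
Import numFieldNormedType.Exports.
Local Open Scope classical_set_scope.
Local Open Scope ring_scope.

(* MathComp-Analysis has Lebesgue measure only on R; R^n is built as   *)
(* the iterated product R * (R * ( ... * R)) with the product measure  *)
(* lebesgue \x (lebesgue \x ...), together with coordinates and        *)
(* coordinatewise subtraction.                                         *)
(* Product of two sigma-finite measures, packaged as a sigma-finite
   measure (the library's canonical instance on product_measure1 is only
   found for subprobabilities, so we copy it onto a fresh constant). *)
Section sf_prod.
Local Open Scope ereal_scope.
Context d1 d2 (T1 : measurableType d1) (T2 : measurableType d2) (R : realType).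
Variables (m1 : {sigma_finite_measure set T1 -> \bar R}) (m2 : {sigma_finite_measure set T2 -> \bar R}).
Definition sf_prod : set (T1 * T2) -> \bar R := (m1 \x m2).
HB.instance Definition _ := Measure.copy sf_prod (m1 \x m2).
Lemma sf_prod_sigma_finite : sigma_finite setT sf_prod.
Proof.
rewrite /sf_prod.
have /sigma_finiteP[F [TF ndF Foo]] := sigma_finiteT m1.
have /sigma_finiteP[G [TG ndG Goo]] := sigma_finiteT m2.
exists (fun n => F n `*` G n).
 rewrite -setXTT TF TG predeqE => -[x y]; split.
    move=> [/= [n _ Fnx] [k _ Gky]]; exists (maxn n k) => //; split.
    - by move: x Fnx; exact/subsetPset/ndF/leq_maxl.
    - by move: y Gky; exact/subsetPset/ndG/leq_maxr.
  by move=> [n _ []/= ? ?]; split; exists n.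
move=> k; have [? ?] := Foo k; have [? ?] := Goo k.
split; first exact: measurableX.
by rewrite product_measure1E// lte_mul_pinfty// ge0_fin_numE.
Qed.
HB.instance Definition _ := Measure_isSigmaFinite.Build _ _ _ sf_prod sf_prod_sigma_finite.
End sf_prod.
Record euc_space (R : realType) := EucSpace {
  es_disp : measure_display;
  es_type : measurableType es_disp;
  es_mu : {sigma_finite_measure set es_type -> \bar R};
  es_coord : es_type -> nat -> R;
  es_sub : es_type -> es_type -> es_type  (* coordinatewise x - y *) }.

(* Rspace R n models R^(n+1). *)
Fixpoint Rspace (R : realType) (n : nat) : euc_space R :=
  match n with
  | 0 => @EucSpace R _ _ (@lebesgue_measure R)
           (fun x i => if i is 0 then x else 0) (fun x y => x - y)
  | n'.+1 =>
      let S := Rspace R n' in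
      @EucSpace R _ _ (@sf_prod _ _ _ _ R (@lebesgue_measure R) (@es_mu _ S))
        (fun p i => if i is i'.+1 then @es_coord _ S p.2 i' else p.1)
        (fun p q => (p.1 - q.1, @es_sub _ S p.2 q.2))
  end.

(* R^N, for N >= 1 (the statement assumes 0 < N). *)
Definition RN (R : realType) (N : nat) : euc_space R := Rspace R N.-1.
Definition pt (R : realType) (N : nat) : measurableType (es_disp (RN R N)) :=
  es_type (RN R N).
Definition lebN (R : realType) (N : nat) : {sigma_finite_measure set pt R N -> \bar R} :=
  @es_mu _ (RN R N).
Definition coord {R : realType} {N : nat} (x : pt R N) (i : nat) : R :=
  @es_coord _ (RN R N) x i.
Definition psub {R : realType} {N : nat} (x y : pt R N) : pt R N :=
  @es_sub _ (RN R N) x y.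

Section geometry.
Context {R : realType} {N : nat}.
Local Notation P := (pt R N).

Definition enorm (z : P) : R := Num.sqrt (\sum_(i < N) coord z i ^+ 2).
Definition edist (x y : P) : R := enorm (psub y x).

Definition oball (x : P) (r : R) : set P := [set y | edist x y < r].
Definition cball (x : P) (r : R) : set P := [set y | edist x y <= r].
Definition B1 : set P := [set z | enorm z < 1].
Definition B1_of (Omega : set P) : set P := \bigcup_(x in Omega) oball x 1.

Definition is_open (Omega : set P) : Prop :=
  forall x, Omega x -> exists2 r : R, 0 < r & oball x r `<=` Omega.
Definition is_bounded (Omega : set P) : Prop :=
  exists (c : P) (M : R), Omega `<=` oball c M.
Definition eclosure (Omega : set P) : set P :=
  [set x | forall e : R, 0 < e -> exists y, Omega y /\ edist x y < e].
Definition eboundary (Omega : set P) : set P := eclosure Omega `\` Omega.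

Definition uniform_exterior_sphere (Omega : set P) : Prop :=
  exists2 r : R, 0 < r &
    forall x0, eboundary Omega x0 ->
      exists y : P, edist y x0 = r /\ oball y r `<=` ~` Omega.

Definition continuous_on (A : set P) (u : P -> R) : Prop :=
  forall x, A x -> forall e : R, 0 < e -> exists2 d : R, 0 < d &
    forall y, A y -> edist x y < d -> `|u x - u y| < e.

Definition dini_modulus (omega : R -> R) : Prop :=
  (forall r, 0 <= r -> 0 <= omega r) /\
  {in `[0, +oo[ &, {homo omega : a b / a <= b}} /\
  (\int[lebesgue_measure]_(r in `]0%R, 1%R]) (omega r / r)%:E < +oo)%E.

Definition dini_loc (Omega : set P) (u : P -> R) : Prop :=
  forall (x0 : P) (r : R), 0 < r -> cball x0 r `<=` Omega ->
    exists omega : R -> R, dini_modulus omega /\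
      forall x y, cball x0 r x -> cball x0 r y -> `|u x - u y| <= omega (edist x y).

Definition Linfty_norm (A : set P) (f : P -> R) : \bar R :=
  Lnorm (lebN R N) +oo%E (fun x => (\1_A x * f x)%:E).

Definition LK (K : P -> P -> R) (u : P -> R) (x : P) : R :=
  (\int[lebN R N]_(y in oball x 1)
     ((u x - u y) / (edist x y ^+ N) * K x (psub y x)))%R.

Definition ell (rho : R) : R := `|ln (Num.min rho (10%:R)^-1)|^-1.

Definition log_holder_semi (alpha : R) (U : set P) (u : P -> R) : \bar R :=
  ereal_sup [set z : \bar R | exists x y, [/\ U x, U y, x <> y &
      z = (`|u x - u y| / (ell (edist x y) `^ alpha))%:E]].

Definition Lalpha_space (alpha : R) (U : set P) (u : P -> R) : Prop :=
  (Linfty_norm U u + log_holder_semi alpha U u < +oo)%E.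

End geometry.

(* Main.v *)
(** The estimate follows from doubling the variables.  Extend [u] by zero and let
    [(x, y)] maximise [u x - u y - A * phi (|x - y|)], where [phi r] is [|ln r|^(-a)] up to
    normalisation, and suppose that the maximum is positive.  Every jump of length at least
    [rho = |x - y|] that the kernels at [x] and at [y] can make to the same point removes the
    whole difference [u x - u y]; when [y] lies on the boundary, the jumps of [x] into the
    exterior ball do the same.  As the kernels have order zero, each of the [~ |ln rho|]
    dyadic shells carries a comparable mass, so the total gain is at least
    [c * lam * |ln rho| * A * phi rho].  Maximality bounds the loss on the shell of radius
    [2^-i] by [phi (2^-i) - phi rho], and these sum up to at most
    [C * Lam * (a * |ln rho| + 1) * A * phi rho].  For [a] small and [rho] small the gain
    wins, which contradicts the boundedness of [L_K u] once [A] is a large multiple of its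
    norm.  Large [rho] are excluded by the bound of [sup |u|] in terms of [L_K u], obtained
    from an exponential barrier in the first coordinate.  [K] is only measurable, hence all
    this takes place at almost every point near the maximum point, and the Dini modulus of
    [u] controls the error coming from short jumps. *)

From HB Require Import structures.
From mathcomp Require Import all_boot all_order all_algebra.
From mathcomp Require Import all_classical all_reals all_analysis.
From mathcomp Require Import measurable_realfun ess_sup_inf.
From mathcomp Require Import ring lra zify.
Require Import Defs.
Set Implicit Arguments.
Unset Strict Implicit.
Unset Printing Implicit Defensive.
Import Order.TTheory GRing.Theory Num.Theory.
Import numFieldNormedType.Exports.
Local Open Scope classical_set_scope.
Local Open Scope ring_scope.

(** * Coordinates and distance *)

(** The kernels at two points are comparable in size only, so the two integrands cannot simply be
    subtracted. Instead a function [g] with a controlled integral is added to each of them.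
    Afterwards any fraction [m] below [lam] times the inverse power of the distance may be kept and
    the rest dropped ([loss_majorant]). Keeping the same [m] at [x] and at [y] makes the values of
    [u] at the common landing point cancel.

    Since the equation is available only near the maximum point, maximality holds up to an error [e]
    on each shell, and such errors are not summable over infinitely many shells. The Dini tail is
    uniform near the maximum point: it fixes first the shell beyond which [e] is no longer used, and
    [e] is chosen afterwards.

    The factor [a] in the loss comes from a cancellation: over the first [k] shells the sum of
    [(i+1)^(-a)] is about [k^(1-a) / (1-a)], and subtracting [k * phi rho] leaves about
    [2 * a * k * phi rho]. So [a] is dictated by the ratio of gain to loss per shell, while the
    terms without the factor [k] are absorbed by taking [rho] small. *)

Section coordinates.
Context {R : realType}.

Lemma Rspace_coord_sub n (x y : es_type (Rspace R n)) i :
  es_coord (es_sub x y) i = es_coord x i - es_coord y i.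
Proof.
elim: n x y i => [|n IH] x y [|i] //=; first by rewrite subr0.
Qed.

Lemma Rspace_coord_inj n (x y : es_type (Rspace R n)) :
  (forall i, (i < n.+1)%N -> es_coord x i = es_coord y i) -> x = y.
Proof.
elim: n x y => [|n IH] x y H; first exact: (H 0).
case: x y H => [x1 x2] [y1 y2] H; congr pair; first exact: (H 0).
by apply: IH => i ilt; exact: (H i.+1).
Qed.

Fixpoint mkR n : (nat -> R) -> es_type (Rspace R n) :=
  match n with
  | 0 => fun f => f 0%N
  | n'.+1 => fun f => (f 0%N, mkR n' (fun i => f i.+1))
  end.

Lemma coord_mkR n (f : nat -> R) i : (i < n.+1)%N -> es_coord (mkR n f) i = f i.
Proof.
by elim: n f i => [|n IH] f [|i] //= ilt; rewrite IH.
Qed.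

Variable N : nat.
Local Notation P := (pt R N).

Lemma coord_psub (x y : P) i : coord (psub x y) i = coord x i - coord y i.
Proof. exact: Rspace_coord_sub. Qed.

Lemma edistE (x y : P) :
  edist x y = Num.sqrt (\sum_(i < N) (coord y i - coord x i) ^+ 2).
Proof. by congr Num.sqrt; apply: eq_bigr => i _; rewrite coord_psub. Qed.

Definition mkpt (f : nat -> R) : P := mkR N.-1 f.

Lemma coord_mkpt (f : nat -> R) (i : 'I_N) : coord (mkpt f) i = f i.
Proof. by apply: coord_mkR; case: N i => [[]|n []]. Qed.

Lemma edist_ge0 (x y : P) : 0 <= edist x y.
Proof. exact: sqrtr_ge0. Qed.

Lemma edistxx (x : P) : edist x x = 0.
Proof. by rewrite edistE big1 ?sqrtr0// => i _; rewrite subrr expr0n. Qed.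

Lemma edistC (x y : P) : edist x y = edist y x.
Proof. by rewrite !edistE; congr Num.sqrt; apply: eq_bigr => i _; ring. Qed.

Lemma l2_sum_sqr (a : 'I_N -> R) : Num.sqrt (\sum_i a i ^+ 2) ^+ 2 = \sum_i a i ^+ 2.
Proof. by rewrite sqr_sqrtr// sumr_ge0// => i _; rewrite sqr_ge0. Qed.

(** Expanding the sum of the squares of [a i * B - b i * A] gives [2 * A * B] times the gap in the
    inequality. Where [A] or [B] vanishes this says nothing, and all terms are zero. *)
Lemma cauchy_schwarz (a b : 'I_N -> R) :
  \sum_i a i * b i <= Num.sqrt (\sum_i a i ^+ 2) * Num.sqrt (\sum_i b i ^+ 2).
Proof.
set A := Num.sqrt (\sum_i a i ^+ 2); set B := Num.sqrt (\sum_i b i ^+ 2).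
have A0 : 0 <= A by exact: sqrtr_ge0.
have B0 : 0 <= B by exact: sqrtr_ge0.
have aux1 (p q s t : R) :
  (p * s - q * t) ^+ 2 = s ^+ 2 * p ^+ 2 + t ^+ 2 * q ^+ 2 - 2 * t * s * (p * q).
  by ring.
have aux2 (s t p : R) :
  s ^+ 2 * t ^+ 2 + t ^+ 2 * s ^+ 2 - 2 * t * s * p = 2 * t * s * (t * s - p).
  by ring.
have H : 0 <= \sum_i (a i * B - b i * A) ^+ 2.
  by apply: sumr_ge0 => i _; rewrite sqr_ge0.
have E : \sum_i (a i * B - b i * A) ^+ 2 =
    2 * A * B * (A * B - \sum_i a i * b i).
  transitivity (B ^+ 2 * (\sum_i a i ^+ 2) + A ^+ 2 * (\sum_i b i ^+ 2)
     - 2 * A * B * \sum_i a i * b i).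
    rewrite !mulr_sumr -big_split -sumrB/=; apply: eq_bigr => i _; exact: aux1.
  by rewrite -(l2_sum_sqr a) -(l2_sum_sqr b) -/A -/B aux2.
have zero (f : 'I_N -> R) : Num.sqrt (\sum_i f i ^+ 2) = 0 -> forall i, f i = 0.
  move=> /(congr1 (fun z => z ^+ 2)); rewrite l2_sum_sqr expr0n /= => /eqP.
  rewrite psumr_eq0; last by move=> i _; rewrite sqr_ge0.
  by move=> /allP z i; apply/eqP; rewrite -sqrf_eq0; apply: z; rewrite mem_index_enum.
have [A0'|An0] := eqVneq A 0.
  by rewrite A0' mul0r big1// => i _; rewrite (zero a A0') mul0r.
have [B0'|Bn0] := eqVneq B 0.
  by rewrite B0' mulr0 big1// => i _; rewrite (zero b B0') mulr0.
have AB : 0 < 2 * A * B by rewrite !mulr_gt0// lt0r ?An0 ?Bn0.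
by rewrite E pmulr_rge0// subr_ge0 in H.
Qed.

Lemma edist_triangle (y x z : P) : edist x z <= edist x y + edist y z.
Proof.
rewrite -(@ler_pXn2r _ 2)// ?nnegrE ?addr_ge0 ?edist_ge0//.
rewrite sqrrD !edistE !l2_sum_sqr.
have := cauchy_schwarz (fun i => coord y i - coord x i) (fun i => coord z i - coord y i).
rewrite -(ler_pMn2r (isT : (0 < 2)%N)) => CS.
rewrite [leRHS]addrAC; apply: le_trans (lerD (lexx _) CS).
rewrite -sumrMnl -!big_split /= le_eqVlt; apply/orP; left; apply/eqP.
by apply: eq_bigr => i _; ring.
Qed.

Lemma coord_le_edist (x y : P) (i : 'I_N) : `|coord y i - coord x i| <= edist x y.
Proof.
rewrite edistE -sqrtr_sqr ler_wsqrtr// (bigD1 i)//= lerDl.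
by apply: sumr_ge0 => j _; rewrite sqr_ge0.
Qed.

Lemma edist_le_coord (x y : P) (r : R) : 0 <= r ->
  (forall i : 'I_N, `|coord y i - coord x i| <= r) -> edist x y <= N%:R * r.
Proof.
move=> r0 H; rewrite -(@ler_pXn2r _ 2)// ?nnegrE ?edist_ge0 ?mulr_ge0//.
rewrite edistE l2_sum_sqr; apply: (@le_trans _ _ (\sum_(i < N) r ^+ 2)).
  apply: ler_sum => i _; rewrite -real_normK ?num_real//.
  by rewrite ler_pXn2r// nnegrE.
rewrite sumr_const card_ord exprMn -[leLHS]mulr_natl ler_wpM2r ?sqr_ge0//.
by rewrite -natrX ler_nat; case: N => // n; rewrite -[leqLHS]expn1 leq_pexp2l.
Qed.

Lemma edist_gt0 (x y : P) : (0 < N)%N -> x <> y -> 0 < edist x y.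
Proof.
move=> N0 xy; rewrite lt0r edist_ge0 andbT; apply/eqP => d0; apply: xy.
apply: Rspace_coord_inj => i ilt.
have ilt' : (i < N)%N by case: (N) N0 ilt.
have := coord_le_edist x y (Ordinal ilt'); rewrite d0 normr_le0 subr_eq0 => /eqP.
by move/esym.
Qed.

Definition lerp (x z : P) (t : R) : P :=
  mkpt (fun i => coord x i + t * (coord z i - coord x i)).

Lemma edist_lerp (x z : P) (s t : R) :
  edist (lerp x z s) (lerp x z t) = `|t - s| * edist x z.
Proof.
rewrite !edistE -sqrtr_sqr -sqrtrM ?sqr_ge0// mulr_sumr; congr Num.sqrt.
by apply: eq_bigr => i _; rewrite !coord_mkpt; ring.
Qed.

Lemma edist_lerpl (x z : P) (t : R) : edist x (lerp x z t) = `|t| * edist x z.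
Proof.
rewrite !edistE -sqrtr_sqr -sqrtrM ?sqr_ge0// mulr_sumr; congr Num.sqrt.
by apply: eq_bigr => i _; rewrite !coord_mkpt; ring.
Qed.

Lemma edist_lerpr (x z : P) (t : R) : edist (lerp x z t) z = `|1 - t| * edist x z.
Proof.
rewrite !edistE -sqrtr_sqr -sqrtrM ?sqr_ge0// mulr_sumr; congr Num.sqrt.
by apply: eq_bigr => i _; rewrite !coord_mkpt; ring.
Qed.

Definition shift0 (x : P) (s : R) : P := mkpt (fun i => coord x i + (i == 0%N)%:R * s).

Lemma edist_shift0 (x : P) (s : R) : (0 < N)%N -> edist x (shift0 x s) = `|s|.
Proof.
move=> N0; rewrite edistE -sqrtr_sqr; congr Num.sqrt.
rewrite (bigD1 (Ordinal N0))// big1 => [|i ni].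
  by rewrite coord_mkpt/=; ring.
rewrite coord_mkpt; have -> : (i == 0%N :> nat) = false.
  by apply/negbTE; move: ni; apply: contra => /eqP i0; apply/eqP/val_inj.
by rewrite mul0r addr0 subrr expr0n.
Qed.

Lemma coord_shift0 (x : P) (s : R) : (0 < N)%N -> coord (shift0 x s) 0 = coord x 0 + s.
Proof. by move=> N0; rewrite (coord_mkpt _ (Ordinal N0))/= mul1r. Qed.

(** The supremum of the parameters at which the segment lies in [Omega] gives the boundary point: it
    is in the closure, and if it were in [Omega], openness would allow a larger parameter. It later
    replaces a point outside [Omega] by one no farther from [x] where an exterior ball is
    available. *)
Lemma open_segment_exit (Omega : set P) (x z : P) :
  is_open Omega -> Omega x -> ~ Omega z ->
  exists y, eboundary Omega y /\ edist x y <= edist x z.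
Proof.
move=> oO Ox nOz.
have d0 : 0 < edist x z.
  rewrite lt0r edist_ge0 andbT; apply/eqP => d0; apply: nOz.
  by have [r r0] := oO x Ox; apply; rewrite /oball/= d0.
pose T := [set t : R | 0 <= t <= 1 /\ Omega (lerp x z t)].
have T0 : T 0.
  split; first by rewrite lexx ler01.
  by have [r r0] := oO x Ox; apply; rewrite /oball/= edist_lerpl normr0 mul0r.
have supT : has_sup T.
  by split; [exists 0 | exists 1 => t [/andP[_ ?] _]].
pose s := sup T.
have s0 : 0 <= s by apply: ub_le_sup => //; case: supT.
have s1 : s <= 1 by apply: ge_sup; [exists 0 | move=> t [/andP[_ ?] _]].
exists (lerp x z s); split; last first.
  by rewrite edist_lerpl ger0_norm// ler_piMl// ltW.
split.
  move=> e e0; have [t Tt tlt] : exists2 t, T t & s - e / edist x z < t.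
    by apply: sup_adherent => //; rewrite divr_gt0.
  exists (lerp x z t); split; first by case: Tt.
  have ts : t <= s by apply: ub_le_sup => //; case: supT.
  rewrite edist_lerp ler0_norm ?subr_le0// -ltr_pdivlMr// opprB.
  by rewrite ltrBlDr -ltrBlDl.
move=> Os; have [r r0 rO] := oO _ Os.
have [s1'|sn1] := eqVneq s 1.
  apply: nOz; apply: rO; rewrite /oball /= edist_lerpr s1'.
  by rewrite subrr normr0 mul0r.
have slt1 : s < 1 by rewrite lt_neqAle sn1.
pose t := Num.min 1 (s + r / 2 / edist x z).
have st : s < t by rewrite lt_min slt1/= ltrDl !divr_gt0.
suff Tt : T t by have := ub_le_sup (proj2 supT) Tt; rewrite -/s leNgt st.
split; first by rewrite (le_trans s0 (ltW st))/= ge_min lexx.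
apply: rO; rewrite /oball/= edist_lerp ger0_norm ?subr_ge0 ?ltW//.
rewrite -ltr_pdivlMr// ltrBlDl (@le_lt_trans _ _ (s + r / 2 / edist x z))//.
  by rewrite ge_min lexx orbT.
by rewrite ltrD2l ltr_pM2r ?invr_gt0//; lra.
Qed.

End coordinates.

(** * Lebesgue measure of balls *)

Section euclidean_measure.
Context {R : realType}.

Lemma measurable_Rspace_coord n i :
  measurable_fun setT (fun w : es_type (Rspace R n) => es_coord w i).
Proof.
elim: n i => [|n IH] [|i] /=.
- exact: measurable_id.
- exact: measurable_cst.
- exact: measurable_fst.
- exact: (measurableT_comp (IH i) measurable_snd).
Qed.

Lemma measurable_Rspace_sub n (x : es_type (Rspace R n)) :
  measurable_fun setT (fun w => es_sub w x).
Proof.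
elim: n x => [|n IH] x /=.
  by apply: measurable_funB; [exact: measurable_id|exact: measurable_cst].
apply: measurable_fun_pair.
  by apply: measurable_funB; [exact: measurable_fst|exact: measurable_cst].
exact: (measurableT_comp (IH x.2) measurable_snd).
Qed.

Definition rbox n (x : es_type (Rspace R n)) (r : R) : set (es_type (Rspace R n)) :=
  [set w | forall i, (i < n.+1)%N -> `|es_coord w i - es_coord x i| < r].

Lemma rbox0 (x : es_type (Rspace R 0)) r :
  rbox x r = `](x : R) - r, (x : R) + r[%classic.
Proof.
rewrite /rbox; apply/seteqP; split => w /=.
  by move=> /(_ 0%N isT); rewrite in_itv/= ltr_distl.
by rewrite in_itv/= -ltr_distl => wx [].
Qed.

Lemma rboxS n (x : es_type (Rspace R n.+1)) r :
  rbox x r = `]x.1 - r, x.1 + r[%classic `*` rbox x.2 r.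
Proof.
apply/seteqP; split => w /=.
  move=> H; split; first by have := H 0%N isT; rewrite /= in_itv/= ltr_distl.
  by move=> i ilt; exact: (H i.+1).
by move=> [] /=; rewrite in_itv/= -ltr_distl => H1 H2 [|i] //= ilt; exact: H2.
Qed.

Lemma measurable_rbox n (x : es_type (Rspace R n)) r : measurable (rbox x r).
Proof.
elim: n x => [|n IH] x; first by rewrite rbox0; exact: measurable_itv.
by rewrite rboxS; apply: measurableX; [exact: measurable_itv|exact: IH].
Qed.

Lemma mu_rbox n (x : es_type (Rspace R n)) r : 0 < r ->
  es_mu (Rspace R n) (rbox x r) = ((2 * r) ^+ n.+1)%:E.
Proof.
move=> r0; have itv (a : R) : lebesgue_measure `]a - r, a + r[%classic = (2 * r)%:E.
  rewrite lebesgue_measure_itv/= lte_fin ifT; last by lra.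
  by congr EFin; ring.
elim: n x => [|n IH] x; first by rewrite rbox0 /= itv.
rewrite rboxS /= /sf_prod product_measure1E.
- by rewrite exprS EFinM; congr (_ * _)%E; [exact: itv|exact: IH].
- exact: measurable_itv.
- exact: measurable_rbox.
Qed.

(** On the line this is uniqueness of Lebesgue measure, tested on half-open intervals; each further
    coordinate is added by slicing. It turns null sets of jumps [w - x] into null sets of landing
    points [w]. *)
Lemma Rspace_preimage_sub n (x : es_type (Rspace R n)) (A : set (es_type (Rspace R n))) :
  measurable A ->
  es_mu (Rspace R n) ((fun w => es_sub w x) @^-1` A) = es_mu (Rspace R n) A.
Proof.
have leb (a : R) (B : set R) : measurable B ->
    lebesgue_measure B =
    pushforward lebesgue_measure (fun w : measurableTypeR R => w - a : measurableTypeR R) B.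
  move=> mB; apply: lebesgue_measure_unique => //=.
    by apply: measurable_funB; [exact: measurable_id|exact: measurable_cst].
  move=> _ _ [[p q]] _ <-; rewrite /pushforward/=.
  have -> : (fun w => w - a) @^-1` `]p, q]%classic = `]p + a, q + a]%classic.
    by apply/seteqP; split => w /=; rewrite !in_itv/= ltrBrDr lerBlDr.
  rewrite !lebesgue_measure_itv/= !lte_fin ltrD2r; case: ifP => // _.
  by congr EFin; ring.
elim: n x A => [|n IH] x A mA; first by rewrite /= [in RHS](leb x).
pose f := fun w : measurableTypeR R => w - x.1 : measurableTypeR R.
have mf : measurable_fun setT f.
  by apply: measurable_funB; [exact: measurable_id|exact: measurable_cst].
rewrite /= /sf_prod /product_measure1.
transitivity (\int[pushforward lebesgue_measure f]_a ((es_mu (Rspace R n) \o xsection A) a))%E.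
  rewrite ge0_integral_pushforward//; last exact: measurable_fun_xsection.
  rewrite preimage_setT; apply: eq_integral => a _ /=.
  rewrite /= -[RHS](IH x.2); last exact: measurable_xsection.
  by congr (es_mu _ _); apply/seteqP; split => w /=; rewrite /xsection/= !inE.
apply: eq_measure_integral => //= B mB _; exact/esym/leb.
Qed.

(** [edist_le_coord] costs the dimension [n.+1] as a factor; dividing by [n.+2] makes the inequality
    strict. *)
Lemma Rspace_box_le_ball n (x : pt R n.+1) r : 0 < r ->
  rbox x (r / n.+2%:R) `<=` oball x r.
Proof.
move=> r0 w H; rewrite /oball/=.
have r0' : 0 <= r / n.+2%:R by rewrite divr_ge0// ltW.
apply: (@le_lt_trans _ _ (n.+1%:R * (r / n.+2%:R))).
  by apply: edist_le_coord => // i; apply/ltW/H.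
by rewrite mulrCA gtr_pMr// ltr_pdivrMr// mul1r ltr_nat.
Qed.

Variable n : nat.
Local Notation P := (pt R n.+1).
Local Notation mu := (lebN R n.+1).

Lemma oball_le_box (x : P) r : oball x r `<=` rbox x r.
Proof.
move=> w wr i ilt; apply: le_lt_trans wr.
exact: (coord_le_edist x w (Ordinal ilt)).
Qed.

Lemma measurable_edist (x : P) : measurable_fun setT (edist x).
Proof.
apply: (measurableT_comp (f := @Num.sqrt R)).
  by apply: continuous_measurable_fun; exact: sqrt_continuous.
apply: measurable_sum => i; apply: measurable_funX.
apply: (eq_measurable_fun (fun w => coord w i - coord x i)).
  by move=> w _; rewrite coord_psub.
by apply: measurable_funB; [exact: measurable_Rspace_coord|exact: measurable_cst].
Qed.

Lemma measurable_edist_preimage (x : P) (i : interval R) :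
  measurable [set w : P | edist x w \in i].
Proof.
rewrite -[X in measurable X]setTI.
exact: (measurable_edist x measurableT (measurable_itv i)).
Qed.

Lemma measurable_oball (x : P) r : measurable (oball x r).
Proof.
have -> : oball x r = [set w : P | edist x w \in `]-oo, r[] by [].
exact: measurable_edist_preimage.
Qed.

Lemma mu_oball_le (x : P) r : 0 < r -> (mu (oball x r) <= ((2 * r) ^+ n.+1)%:E)%E.
Proof.
move=> r0; rewrite -(mu_rbox x r0); apply: le_measure; rewrite ?inE.
- exact: measurable_oball.
- exact: measurable_rbox.
- exact: oball_le_box.
Qed.

Lemma mu_oball_ge (x : P) r : 0 < r -> (((r / n.+2%:R) ^+ n.+1)%:E <= mu (oball x r))%E.
Proof.
move=> r0; have r0' : 0 < r / n.+2%:R by rewrite divr_gt0.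
apply: (@le_trans _ _ (mu (rbox x (r / n.+2%:R)))).
  rewrite /lebN/= mu_rbox// lee_fin; move: (r / n.+2%:R) r0' => t t0.
  by apply: lerXn2r; rewrite ?nnegrE; lra.
apply: le_measure; rewrite ?inE.
- exact: measurable_rbox.
- exact: measurable_oball.
- exact: Rspace_box_le_ball.
Qed.

(** [is_open] speaks of distances, measurability of a product sigma-algebra. The link is that [O] is
    the union of the countably many boxes inside it with rational centres and half-widths
    [m.+1%:R^-1]. *)
Lemma is_open_measurable (O : set P) : is_open O -> measurable O.
Proof.
move=> oO.
pose q (f : {ffun 'I_n.+1 -> rat}) : P :=
  mkpt n.+1 (fun i => if insub i is Some j then ratr (f j) else 0).
have qE f (i : 'I_n.+1) : coord (q f) i = ratr (f i).
  by rewrite coord_mkpt; case: insubP => [j _ /val_inj -> //|]; rewrite ltn_ord.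
pose F (u : {ffun 'I_n.+1 -> rat} * nat) : set P :=
  [set w | rbox (q u.1) u.2.+1%:R^-1 w /\ rbox (q u.1) u.2.+1%:R^-1 `<=` O].
have -> : O = \bigcup_u F u.
  apply/seteqP; split => [x Ox|x [u _ [Fx FO]]]; last exact: FO.
  have [r r0 rO] := oO x Ox.
  have [m mr] : exists m : nat, m.+1%:R^-1 < r / n.+2%:R / 2.
    have rr : 0 < r / n.+2%:R / 2 by rewrite !divr_gt0.
    have [m] := ltr_add_invr rr; rewrite add0r => mr; by exists m.
  have xq (i : 'I_n.+1) : exists p : rat, `|ratr p - coord x i| < m.+1%:R^-1.
    have : coord x i - m.+1%:R^-1 < coord x i + m.+1%:R^-1.
      by rewrite ltrD2l gtrN// invr_gt0.
    by move=> /rat_in_itvoo[p]; rewrite in_itv/= -ltr_distl => ?; exists p.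
  have [f fP] := choice xq.
  exists ([ffun i => f i], m) => //; split => /=.
    move=> i ilt; have := qE [ffun i => f i] (Ordinal ilt); rewrite /coord/= => ->.
    by rewrite ffunE distrC; exact: (fP (Ordinal ilt)).
  move=> w wq; apply: rO; apply: Rspace_box_le_ball => // i ilt.
  have H1 := wq i ilt; have := qE [ffun i => f i] (Ordinal ilt).
  rewrite /coord/= ffunE => E; rewrite E in H1.
  have H2 := fP (Ordinal ilt); rewrite /coord/= in H2.
  have := ler_distD (ratr (f (Ordinal ilt))) (es_coord w i) (es_coord x i).
  move/le_lt_trans; apply.
  apply: (@lt_trans _ _ (m.+1%:R^-1 + m.+1%:R^-1)); first exact: ltrD.
  by move: mr; move: (m.+1%:R^-1) (r / n.+2%:R) => a b; lra.
apply: countable_bigcupT_measurable; first exact: countableP.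
move=> u; have [FO|nFO] := pselect (rbox (q u.1) u.2.+1%:R^-1 `<=` O).
  rewrite (_ : F u = rbox (q u.1) u.2.+1%:R^-1); first exact: measurable_rbox.
  by apply/seteqP; split => [w []|w] //=.
rewrite (_ : F u = set0); first exact: measurable0.
by apply/seteqP; split => [w []|w] //=.
Qed.

Lemma is_open_B1_of (O : set P) : is_open (B1_of O).
Proof.
move=> w [x Ox xw]; exists (1 - edist x w); first by rewrite subr_gt0.
move=> v wv; exists x => //; rewrite /oball/= in wv *.
by apply: le_lt_trans (edist_triangle w _ _) _; rewrite -ltrBrDl.
Qed.

Lemma null_preimage_psub (x : P) (A : set P) : measurable A -> mu A = 0%E ->
  mu ((fun w => psub w x) @^-1` A) = 0%E.
Proof. by move=> mA A0; rewrite -A0; exact: Rspace_preimage_sub. Qed.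

Lemma measurable_psub (x : P) : measurable_fun setT (fun w : P => psub w x).
Proof. exact: measurable_Rspace_sub. Qed.

(** Needed in [Linfty_ae], where the norm of exponent [+oo] unfolds to an essential supremum once
    the whole space has positive measure. *)
Lemma mu_gt0 : (0 < mu setT)%E.
Proof.
pose x : P := mkpt n.+1 (fun=> 0).
apply: lt_le_trans (@le_measure _ _ _ mu (oball x 1) setT _ _ _); rewrite ?inE//.
  by apply: lt_le_trans (mu_oball_ge _ _) => //; rewrite lte_fin exprn_gt0.
exact: measurable_oball.
Qed.

End euclidean_measure.

(** * Dyadic shells *)

Section shells.
Context {R : realType}.
Variable n : nat.
Local Notation P := (pt R n.+1).
Local Notation mu := (lebN R n.+1).

Definition dya (i : nat) : R := (2^-1) ^+ i.

Lemma dya_gt0 i : 0 < dya i. Proof. by rewrite exprn_gt0// invr_gt0. Qed.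
Lemma dya_ge0 i : 0 <= dya i. Proof. exact/ltW/dya_gt0. Qed.
Lemma dya0 : dya 0 = 1. Proof. by rewrite /dya expr0. Qed.
Lemma dyaS i : dya i.+1 = dya i / 2. Proof. by rewrite /dya exprSr. Qed.
Lemma dya_le i j : (i <= j)%N -> dya j <= dya i.
Proof. by move=> ij; rewrite ler_wiXn2l//; lra. Qed.
Lemma dyaV i : (dya i)^-1 = 2 ^+ i. Proof. by rewrite /dya exprVn invrK. Qed.

Lemma dya_small (e : R) : 0 < e -> exists i, dya i < e.
Proof.
move=> e0; have := @cvg_geometric R 1 2^-1.
rewrite ger0_norm ?invr_ge0// => /(_ ltac:(lra)) /cvgrPdist_lt /(_ _ e0)[m _ H].
exists m; have := H m (leqnn m); rewrite /= mul1r sub0r normrN ger0_norm//.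
Qed.

Lemma dya_between (r : R) : 0 < r -> r < 1 -> exists k, dya k.+1 <= r < dya k.
Proof.
move=> r0 r1; have [i ir] := dya_small r0.
elim: i ir => [|i IH]; first by rewrite dya0; lra.
move=> H; have [|ri] := ltP r (dya i); first by exists i; rewrite ltW.
case: i IH H ri => [|i] IH H ri; first by move: ri; rewrite dya0; lra.
by have [|ri'] := ltP r (dya i); [exists i; rewrite ri|apply: IH; rewrite dyaS;
  have := dya_gt0 i; lra].
Qed.

Definition shell (x : P) (i : nat) : set P :=
  [set w | dya i.+1 <= edist x w < dya i].

Lemma measurable_shell x i : measurable (shell x i).
Proof.
have -> : shell x i = [set w : P | edist x w \in `[dya i.+1, dya i[].
  by apply/seteqP; split => w; rewrite /shell/= in_itv.
exact: measurable_edist_preimage.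
Qed.

Lemma shell_inj x i j w : shell x i w -> shell x j w -> i = j.
Proof.
wlog ij : i j / (i <= j)%N.
  by move=> H; case/orP: (leq_total i j) => ? ? ?; [exact: H|apply/esym/H].
rewrite leq_eqVlt in ij; case/orP: ij => [/eqP//|ij] /andP[H1 _] /andP[_ H2].
by have := lt_le_trans H2 (le_trans (dya_le ij) H1); rewrite ltxx.
Qed.

Lemma shell_exists x w : 0 < edist x w -> edist x w < 1 -> exists i, shell x i w.
Proof. exact: dya_between. Qed.

Lemma mu_shell x i : (mu (shell x i) <= ((2 * dya i) ^+ n.+1)%:E)%E.
Proof.
apply: le_trans (mu_oball_le x (dya_gt0 i)); apply: le_measure; rewrite ?inE.
- exact: measurable_shell.
- exact: measurable_oball.
- by move=> w /andP[].
Qed.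

(** The majorant is a step function; its factor [(2 ^+ i.+1) ^+ n.+1] is the largest value of the
    singular kernel on shell [i]. The measure of that shell is at most [(2 * dya i) ^+ n.+1], so its
    contribution is at most [4 ^+ n.+1 * d i], whatever the scale. *)
Lemma shell_majorant (x : P) (d : nat -> R) (X : R) :
  (forall i, 0 <= d i) -> (forall m, \sum_(i < m) d i <= X) ->
  exists g : P -> R, [/\ mu.-integrable setT (EFin \o g), forall w, 0 <= g w,
    forall i w, shell x i w -> d i * (2 ^+ i.+1) ^+ n.+1 <= g w
    & \int[mu]_w g w <= 4 ^+ n.+1 * X].
Proof.
move=> d0 dX; pose c i := d i * (2 ^+ i.+1) ^+ n.+1.
have c0 i : 0 <= c i by rewrite mulr_ge0 ?exprn_ge0.
pose h i (w : P) : \bar R := ((c i)%:E * (\1_(shell x i) w)%:E)%E.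
have h0 i w : (0 <= h i w)%E by rewrite mule_ge0 ?lee_fin.
have mh i : measurable_fun setT (h i).
  apply: emeasurable_funM; first exact: measurable_cst.
  by apply/measurable_EFinP; apply: measurable_indic; exact: measurable_shell.
pose G w := (\sum_(i <oo) h i w)%E.
have Gs i w : shell x i w -> G w = (c i)%:E.
  move=> wi; rewrite /G (nneseriesD1 (n := i))// /h indicE mem_set//= mule1.
  rewrite eseries0 ?adde0//. move=> j _ ji; rewrite indicE memNset ?mule0// => wj.
  by move: ji; rewrite (shell_inj wi wj) eqxx.
have Gn w : ~ (exists i, shell x i w) -> G w = 0%E.
  move=> nw; rewrite /G eseries0// => j _ _; rewrite /h indicE memNset ?mule0// => wj.
  by apply: nw; exists j.
have G0 w : (0 <= G w)%E by exact: nneseries_ge0.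
have Gfin w : G w = (fine (G w))%:E.
  have [[i wi]|nw] := pselect (exists i, shell x i w); first by rewrite (Gs i).
  by rewrite Gn.
have mG : measurable_fun setT G.
  by apply: ge0_emeasurable_sum => // k w _ _.
have intG : (\int[mu]_w G w <= (4 ^+ n.+1 * X)%:E)%E.
  rewrite /G integral_nneseries//.
  apply: lime_le.
    by apply: is_cvg_nneseries => i _ _; exact: integral_ge0.
  apply: nearW => m.
  apply: (@le_trans _ _ (\sum_(0 <= i < m) (4 ^+ n.+1 * d i)%:E)%E).
    apply: lee_sum => i _; rewrite /h ge0_integralZl_EFin//; last first.
      by apply/measurable_EFinP; apply: measurable_indic; exact: measurable_shell.
    rewrite integral_indic ?setIT//; last exact: measurable_shell.
    apply: (@le_trans _ _ ((c i)%:E * ((2 * dya i) ^+ n.+1)%:E)%E).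
      by apply: lee_wpmul2l; [rewrite lee_fin|exact: mu_shell].
    rewrite -EFinM lee_fin /c -mulrA -exprMn.
    have -> : 2 ^+ i.+1 * (2 * dya i) = 4 :> R.
      rewrite exprS mulrACA -dyaV mulVf ?mulr1; last exact/lt0r_neq0/dya_gt0.
      by ring.
    by rewrite mulrC.
  rewrite sumEFin lee_fin -mulr_sumr ler_wpM2l ?exprn_ge0//.
  by rewrite big_mkord.
exists (fine \o G); split.
- have -> : EFin \o (fine \o G) = G by apply/funext => w /=; rewrite -Gfin.
  apply/integrableP; split => //.
  under eq_integral do rewrite gee0_abs//.
  exact: le_lt_trans intG (ltry _).
- by move=> w; exact: fine_ge0.
- by move=> i w wi /=; rewrite (Gs i).
- rewrite /Rintegral -lee_fin fineK//.
    by under eq_integral do rewrite /= -Gfin.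
  under eq_integral do rewrite /= -Gfin.
  rewrite ge0_fin_numE; first exact: le_lt_trans intG (ltry _).
  exact: integral_ge0.
Qed.

(** The lower bound for the measure of a ball of radius [dya j / 16], multiplied by the kernel size
    [(2 ^+ j) ^+ n.+1]: the scale [j] cancels. *)
Definition ball_const : R := ((16 * n.+2%:R) ^+ n.+1)^-1.

Lemma ball_const_gt0 : 0 < ball_const.
Proof. by rewrite invr_gt0 exprn_gt0// mulr_gt0. Qed.

(** The balls lie in different shells, hence are disjoint, and by scale invariance each contributes
    at least [th * ball_const]. This makes the gain proportional to the number of scales. *)
Lemma gain_integral (h : P -> R) (x : P) (p : nat -> P) (a b : nat) (th : R) :
  mu.-integrable setT (EFin \o h) -> (forall w, 0 <= h w) -> 0 <= th ->
  (forall j, (a <= j < b)%N -> oball (p j) (dya j / 16) `<=` shell x j) ->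
  (forall j w, (a <= j < b)%N -> oball (p j) (dya j / 16) w ->
     th * (2 ^+ j) ^+ n.+1 <= h w) ->
  (b - a)%:R * (th * ball_const) <= \int[mu]_w h w.
Proof.
move=> ih h0 th0 psh ph.
pose B j := if (a <= j < b)%N then oball (p j) (dya j / 16) else set0.
have mB j : measurable (B j).
  by rewrite /B; case: ifP => // _; exact: measurable_oball.
have tB : trivIset [set` index_iota a b] B.
  move=> i j _ _ [w []]; rewrite /B; case: ifP => // ai wi; case: ifP => // aj wj.
  exact: shell_inj (psh _ ai _ wi) (psh _ aj _ wj).
have mh : measurable_fun setT (EFin \o h) by case/integrableP : ih.
have fin : (\int[mu]_w (h w)%:E)%E \is a fin_num.
  by apply: integrable_fin_num.
rewrite -lee_fin /Rintegral fineK//.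
apply: (@le_trans _ _ (\int[mu]_(w in \big[setU/set0]_(j <- index_iota a b) B j) (h w)%:E)%E); last first.
  apply: ge0_subset_integral => //; first exact: bigsetU_measurable.
  by move=> w _; rewrite lee_fin.
rewrite ge0_integral_bigsetU//; last 3 first.
- exact: iota_uniq.
- exact: measurable_funS mh.
- by move=> w _; rewrite lee_fin.
apply: (@le_trans _ _ (\sum_(j <- index_iota a b) (th * ball_const)%:E)%E).
  rewrite sumEFin lee_fin big_const_nat iter_addr_0 mulr_natl//.
rewrite big_nat_cond [leRHS]big_nat_cond; apply: lee_sum => j; rewrite andbT => aj.
apply: (@le_trans _ _ (\int[mu]_(w in B j) (th * (2 ^+ j) ^+ n.+1)%:E)%E); last first.
  apply: ge0_le_integral => //.
  - by move=> w _; rewrite lee_fin mulr_ge0// ?exprn_ge0.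
  - exact: measurable_funS mh.
  - by move=> w; rewrite /B aj => wj; rewrite lee_fin; exact: ph.
rewrite integral_cst//.
have dj : 0 < dya j / 16 by rewrite divr_gt0// dya_gt0.
have := mu_oball_ge (p j) dj; rewrite /B aj.
move=> /(lee_wpmul2l (x := (th * (2 ^+ j) ^+ n.+1)%:E)) H.
apply: le_trans (H _); last by rewrite lee_fin mulr_ge0// ?exprn_ge0.
rewrite -EFinM lee_fin -mulrA ler_wpM2l// /ball_const -exprMn -exprVn.
rewrite le_eqVlt; apply/orP; left; apply/eqP; congr (_ ^+ _).
rewrite -dyaV invfM; set t := dya j.
have t0 : t != 0 by exact/lt0r_neq0/dya_gt0.
by rewrite -!mulrA mulKf.
Qed.

End shells.

(** * The logarithmic modulus *)

Section log_modulus.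
Context {R : realType}.
Implicit Types (a r s t : R).

(** The binary logarithm of [1 / r], shifted by 2 and frozen beyond [r = 2]. For positive [r] it is
    at least 1, and it is an integer at each [dya i]. *)
Definition lg r : R := 2 - ln (Num.min r 2) / ln 2.
Definition phi a r : R := if 0 < r then lg r `^ (- a) else 0.

Lemma ln2_gt0 : 0 < ln 2 :> R. Proof. by rewrite ln_gt0// ltr1n. Qed.

Lemma ln2_ge : 2^-1 <= ln 2 :> R.
Proof.
have := @le_ln1Dx R (2^-1 - 1); rewrite (_ : 1 + (2^-1 - 1) = 2^-1 :> R); last by ring.
by rewrite lnV ?posrE// => H; have := H ltac:(lra); lra.
Qed.

Lemma min2_gt0 r : 0 < r -> 0 < Num.min r 2.
Proof. by move=> r0; rewrite lt_min r0/=. Qed.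

Lemma lg_ge1 r : 0 < r -> 1 <= lg r.
Proof.
move=> r0; rewrite /lg lerBrDr -lerBrDl ler_pdivrMr ?ln2_gt0//.
have -> : (2 - 1) * ln 2 = ln 2 :> R by ring.
by rewrite ler_ln ?posrE ?min2_gt0// ge_min lexx orbT.
Qed.

Lemma lg_gt0 r : 0 < r -> 0 < lg r.
Proof. by move=> /lg_ge1; apply: lt_le_trans. Qed.

Lemma lg_le r s : 0 < r -> r <= s -> lg s <= lg r.
Proof.
move=> r0 rs; rewrite /lg lerD2l lerN2 ler_pM2r ?invr_gt0 ?ln2_gt0//.
have s0 := lt_le_trans r0 rs.
by rewrite ler_ln ?posrE ?min2_gt0// le_min !ge_min lexx rs orbT.
Qed.

Lemma lg_lipschitz r t : 0 < r -> 0 <= t -> lg r - lg (r + t) <= 2 * (t / r).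
Proof.
move=> r0 t0; have rt : 0 < r + t by rewrite ltr_wpDr.
have m0 := min2_gt0 r0; have m1 := min2_gt0 rt.
have -> : lg r - lg (r + t) = ln (Num.min (r + t) 2 / Num.min r 2) / ln 2.
  by rewrite ln_div ?posrE// /lg; ring.
have q : Num.min (r + t) 2 / Num.min r 2 <= 1 + t / r.
  rewrite ler_pdivrMr// mulrDl mul1r.
  have [r2|r2] := leP r 2.
    by rewrite -mulrA mulVf ?mulr1 ?gt_eqF// ge_min lexx.
  have : 0 <= t / r * 2 by rewrite mulr_ge0// divr_ge0// ltW.
  by rewrite ge_min => ?; apply/orP; right; lra.
have lnq : ln (Num.min (r + t) 2 / Num.min r 2) <= t / r.
  apply: (@le_trans _ _ (ln (1 + t / r))).
    rewrite ler_ln ?posrE ?divr_gt0//.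
    by rewrite ltr_wpDr// divr_ge0// ltW.
  by apply: le_ln1Dx; rewrite (@lt_le_trans _ _ 0) ?divr_ge0// ltW.
rewrite ler_pdivrMr ?ln2_gt0// (le_trans lnq)//.
have q0 : 0 <= t / r by rewrite divr_ge0// ltW.
by have := ler_wpM2l q0 ln2_ge; lra.
Qed.

Lemma ln_dya i : ln (dya i) = - (i%:R * ln 2) :> R.
Proof.
elim: i => [|i IH]; first by rewrite dya0 ln1 mul0r oppr0.
by rewrite dyaS ln_div ?posrE ?dya_gt0// IH -natr1; ring.
Qed.

Lemma dya_le1 i : dya i <= 1 :> R.
Proof. by rewrite -dya0 dya_le. Qed.

Lemma lg_dya i : lg (dya i) = i%:R + 2.
Proof.
rewrite /lg min_l; last by have := dya_le1 i; lra.
by rewrite ln_dya mulNr mulfK ?gt_eqF ?ln2_gt0//; ring.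
Qed.

Lemma lg_2dya i : lg (2 * dya i) = i%:R + 1.
Proof.
case: i => [|i].
  by rewrite dya0 mulr1 /lg minxx divff ?gt_eqF ?ln2_gt0//; ring.
have -> : 2 * dya i.+1 = dya i :> R by rewrite dyaS; field.
by rewrite lg_dya -natr1; ring.
Qed.

Variable a : R.
Hypothesis a_gt0 : 0 < a.
Hypothesis a_le : a <= 2^-1.

Lemma phi_ge0 r : 0 <= phi a r.
Proof. by rewrite /phi; case: ifP => // _; exact: powR_ge0. Qed.

Lemma powRN_le s t : 0 < s -> s <= t -> t `^ (- a) <= s `^ (- a).
Proof.
move=> s0 st; have t0 := lt_le_trans s0 st.
by rewrite !powRN lef_pV2 ?posrE ?powR_gt0// ge0_ler_powR// ?nnegrE ltW.
Qed.

Lemma phi_le r s : r <= s -> phi a r <= phi a s.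
Proof.
move=> rs; rewrite {1}/phi; case: ifP => [r0|_]; last exact: phi_ge0.
have s0 := lt_le_trans r0 rs.
by rewrite /phi s0 powRN_le// ?lg_gt0// lg_le.
Qed.

Lemma phi_lipschitz r t : 0 < r -> 0 <= t ->
  phi a (r + t) - phi a r <= 2 * (t / r) * phi a r.
Proof.
move=> r0 t0; have rt : 0 < r + t by rewrite ltr_wpDr.
rewrite /phi r0 rt; set x := lg r; set y := lg (r + t).
have y1 : 1 <= y by exact: lg_ge1.
have yx : y <= x by rewrite lg_le// lerDl.
have x0 : 0 < x by lra.
have y0 : 0 < y by lra.
have xy := lg_lipschitz r0 t0; rewrite -/x -/y in xy.
have -> : y `^ (- a) = (x / y) `^ a * x `^ (- a).
  rewrite powRM ?invr_ge0 ?ltW// -powR_inv1 ?ltW// -powRrM mulN1r.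
  by rewrite mulrAC -powRD ?subrr ?powRr0 ?mul1r//; apply/implyP => _; rewrite gt_eqF.
have p0 : 0 <= x `^ (- a) by exact: powR_ge0.
rewrite -[X in _ - X]mul1r -mulrBl ler_wpM2r//.
have xy1 : 1 <= x / y by rewrite ler_pdivlMr// mul1r.
have : (x / y) `^ a <= (x / y) `^ 1 by rewrite ler_powR//; move: a_le => ?; lra.
rewrite powRr1; last by lra.
have : x / y - 1 <= 2 * (t / r); last by lra.
have -> : x / y - 1 = (x - y) / y by rewrite [RHS]mulrBl (divff (lt0r_neq0 y0)).
rewrite ler_pdivrMr//.
have q0 : 0 <= 2 * (t / r) by rewrite mulr_ge0// divr_ge0// ltW.
by apply: le_trans xy _; rewrite ler_peMr.
Qed.

Lemma phi_2dya i : phi a (2 * dya i) = i.+1%:R `^ (- a).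
Proof. by rewrite /phi mulr_gt0 ?dya_gt0// lg_2dya natr1. Qed.

Lemma phi_dya_ge k r : dya k.+1 <= r -> k.+3%:R `^ (- a) <= phi a r.
Proof.
move=> kr; apply: le_trans (phi_le kr).
by rewrite /phi dya_gt0 lg_dya -natr1 -natr1 -addrA.
Qed.

Lemma phi_dya_le k r : r < dya k -> phi a r <= k.+1%:R `^ (- a).
Proof.
by move=> rk; rewrite -phi_2dya phi_le//; have := @dya_ge0 R k; lra.
Qed.

Lemma powR_bernoulli s b : 0 <= s -> 0 <= b <= 1 -> s `^ b <= 1 + b * (s - 1).
Proof.
move=> s0 /andP[b0 b1].
have [->|bn0] := eqVneq b 0; first by rewrite powRr0 mul0r addr0.
have [->|bn1] := eqVneq b 1; first by rewrite powRr1// mul1r addrC subrK.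
have b0' : 0 < b by rewrite lt0r bn0.
have b1' : 0 < 1 - b by rewrite subr_gt0 lt_neqAle bn1.
have := @conjugate_powR R (s `^ b) 1 b^-1 (1 - b)^-1 (powR_ge0 _ _) ler01.
rewrite invr_gt0 b0' invr_gt0 b1' !invrK subrKC => /(_ isT isT erefl).
rewrite mulr1 -powRrM mulfV ?gt_eqF// powRr1// powR1 mul1r.
by move/le_trans; apply; rewrite le_eqVlt; apply/orP; left; apply/eqP; ring.
Qed.

(** An induction in place of a comparison with an integral: the step is Bernoulli's inequality for
    [k / k.+1] with exponent [1 - a]. *)
Lemma sum_powRN k : \sum_(i < k) i.+1%:R `^ (- a) <= k%:R `^ (1 - a) / (1 - a).
Proof.
elim: k => [|k IH]; first by rewrite big_ord0 divr_ge0 ?powR_ge0//; move: a_le => ?; lra.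
rewrite big_ord_recr/=; apply: le_trans (lerD IH (lexx _)) _.
have a1 : 0 < 1 - a by move: a_le => ?; lra.
rewrite ler_pdivlMr// mulrDl divfK ?gt_eqF//.
have K0 : 0 < k.+1%:R :> R by rewrite ltr0n.
have B := @powR_bernoulli (k%:R / k.+1%:R) (1 - a).
have {}B : (k%:R / k.+1%:R) `^ (1 - a) <= 1 + (1 - a) * (k%:R / k.+1%:R - 1).
  by apply: B; [rewrite divr_ge0// ltW|apply/andP; split; move: a_gt0 a_le => ? ?; lra].
have E : k%:R / k.+1%:R - 1 = - k.+1%:R^-1 :> R.
  by rewrite -natr1; field; rewrite natr1 gt_eqF.
rewrite E in B.
have p0 : 0 <= k.+1%:R `^ (1 - a) :> R by exact: powR_ge0.
have := ler_wpM2r p0 B.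
have -> : (k%:R / k.+1%:R) `^ (1 - a) * k.+1%:R `^ (1 - a) = k%:R `^ (1 - a) :> R.
  by rewrite -powRM ?divr_ge0// divfK// gt_eqF.
have -> : k.+1%:R `^ (- a) = k.+1%:R^-1 * k.+1%:R `^ (1 - a) :> R.
  rewrite -(@powR_inv1 _ k.+1%:R)// -powRD; first by congr (_ `^ _); ring.
  by apply/implyP => _; rewrite gt_eqF.
move: (k%:R `^ (1 - a)) (k.+1%:R `^ (1 - a)) (k.+1%:R^-1) => X p q.
by lra.
Qed.

(** Bound for the growth of [phi] when one of two points at distance [r], with
    [dya k.+1 <= r < dya k], jumps by less than [dya i]. For [i < k] the jump scale exceeds [r] and
    the new distance is below [2 * dya i]; for [i >= k] the Lipschitz bound gives geometric
    decay. *)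
Definition loss (k : nat) r (i : nat) : R :=
  if (i < k)%N then i.+1%:R `^ (- a) - phi a r else 4 * 2 ^+ k * dya i * phi a r.

Lemma phi_loss k r i t : dya k.+1 <= r < dya k -> t <= r + dya i ->
  phi a t - phi a r <= loss k r i.
Proof.
move=> /andP[kr rk] tri; rewrite /loss; have r0 := lt_le_trans (@dya_gt0 R k.+1) kr.
case: ifP => ik.
  rewrite lerD2r -phi_2dya phi_le// (le_trans tri)//.
  by have := @dya_le R _ _ (ltnW ik); lra.
apply: le_trans (lerB (phi_le tri) (lexx _)) _.
apply: le_trans (phi_lipschitz r0 (dya_ge0 _)) _.
rewrite ler_wpM2r ?phi_ge0//.
rewrite -[leRHS]mulrA [4 * _]mulrC; apply: (@le_trans _ _ (2 * (dya i * (2 ^+ k.+1)))).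
  rewrite ler_wpM2l// ler_wpM2l ?dya_ge0// -dyaV lef_pV2 ?posrE ?dya_gt0//.
rewrite exprS le_eqVlt; apply/orP; left; apply/eqP; ring.
Qed.

Lemma loss_ge0 k r i : dya k.+1 <= r < dya k -> 0 <= loss k r i.
Proof.
move=> /andP[kr rk]; rewrite /loss; case: ifP => ik.
  rewrite subr_ge0 (le_trans (phi_dya_le rk))// powRN_le//.
  by rewrite ler_nat ltnS ltnW.
by rewrite !mulr_ge0 ?phi_ge0 ?dya_ge0 ?exprn_ge0.
Qed.

Lemma sum_dya m : \sum_(i < m) dya i <= 2 :> R.
Proof.
suff -> : \sum_(i < m) dya i = 2 - 2 * dya m :> R by have := @dya_ge0 R m; lra.
elim: m => [|m IH]; first by rewrite big_ord0 dya0; ring.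
by rewrite big_ord_recr/= IH dyaS; field.
Qed.

Lemma sum_loss k r m : dya k.+1 <= r < dya k ->
  \sum_(i < m) loss k r i <= phi a r * (2 * a * k%:R + 14).
Proof.
move=> krk; have /andP[kr rk] := krk.
have p0 := phi_ge0 r.
apply: (@le_trans _ _ (\sum_(i < k + m) loss k r i)).
  rewrite addnC big_split_ord/= lerDl sumr_ge0// => i _; exact: loss_ge0.
rewrite big_split_ord/=.
have -> : \sum_(i < k) loss k r i = \sum_(i < k) i.+1%:R `^ (- a) - k%:R * phi a r.
  under eq_bigr => i _ do rewrite /loss ltn_ord.
  by rewrite sumrB sumr_const card_ord mulr_natl.
have -> : \sum_(i < m) loss k r (k + i) = 4 * phi a r * \sum_(i < m) dya i.
  rewrite mulr_sumr; apply: eq_bigr => i _; rewrite /loss ltnNge leq_addr/=.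
  rewrite /dya exprD -/(dya k) -/(dya i) -dyaV.
  by have := lt0r_neq0 (@dya_gt0 R k) => ?; field.
have S2 : 4 * phi a r * \sum_(i < m) dya i <= 4 * phi a r * 2.
  by rewrite ler_wpM2l ?sum_dya// mulr_ge0.
have S1 := sum_powRN k.
have S3 : k%:R `^ (1 - a) / (1 - a) <= (k%:R + 3) * phi a r * (1 + 2 * a).
  have a1 : 0 < 1 - a by move: a_le => ?; lra.
  rewrite ler_pdivrMr//.
  have K0 : 0 < k%:R + 3 :> R by rewrite ltr_wpDl.
  apply: (@le_trans _ _ ((k%:R + 3) * phi a r)).
    apply: (@le_trans _ _ ((k%:R + 3) `^ (1 - a))).
      by rewrite ge0_ler_powR ?nnegrE// ?ltW// ltrDl.
    rewrite powRD; last by apply/implyP => _; rewrite gt_eqF.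
    rewrite (powRr1 (ltW K0)) ler_wpM2l ?(ltW K0)//.
    have := phi_dya_ge kr; rewrite -addn3 natrD; apply.
  have Q0 : 0 <= (k%:R + 3) * phi a r by rewrite mulr_ge0 ?(ltW K0).
  have a2 : 0 <= a * (1 - 2 * a) by rewrite mulr_ge0 ?(ltW a_gt0)//; move: a_le => ?; lra.
  by have := mulr_ge0 Q0 a2; lra.
have : 0 <= phi a r * (1 - 2 * a) by rewrite mulr_ge0//; move: a_le => ?; lra.
by lra.
Qed.

Lemma phi_nat_ge k r : dya k.+1 <= r -> k.+3%:R^-1 <= phi a r.
Proof.
move=> kr; apply: le_trans (phi_dya_ge kr).
by rewrite -powR_inv1// ler_powR ?ler1n//; move: a_le => ?; lra.
Qed.

Lemma phi_continuous r e : 0 < r -> 0 < e ->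
  exists2 d, 0 < d & forall s, `|r - s| < d -> `|phi a r - phi a s| < e.
Proof.
move=> r0 e0.
have r2 : 0 < r / 2 by rewrite divr_gt0.
pose d := Num.min (r / 2) (Num.min 1 e * r / 8).
exists d.
  rewrite lt_min r2 divr_gt0 ?mulr_gt0// lt_min e0 ltr01//.
have le1 s : 0 < s -> phi a s <= 1.
  move=> s0; rewrite /phi s0 -[leRHS](powRr0 (lg s)) ler_powR ?lg_ge1//.
  by rewrite oppr_le0 ltW.
have main s t : r / 2 <= s -> 0 <= t -> t < d -> `|phi a s - phi a (s + t)| < e.
  move=> rs t0 td; have s0 := lt_le_trans r2 rs.
  rewrite distrC ger0_norm; last by rewrite subr_ge0 phi_le// lerDl.
  apply: le_lt_trans (phi_lipschitz s0 t0) _.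
  apply: (@le_lt_trans _ _ (2 * (t / s))).
    by rewrite ler_piMr ?le1// mulr_ge0// divr_ge0// ltW.
  have td' : t < e * r / 8.
    apply: lt_le_trans td _; rewrite ge_min; apply/orP; right.
    by rewrite !ler_pM2r ?invr_gt0// ge_min lexx orbT.
  rewrite mulrA ltr_pdivrMr//.
  have := ler_wpM2l (ltW e0) rs.
  have := mulr_gt0 e0 r0.
  by lra.
move=> s; have [rs|sr] := leP r s.
  rewrite ler0_norm ?subr_le0// opprB => H.
  have := @main r (s - r); rewrite subrKC; apply => //; lra.
rewrite gtr0_norm ?subr_gt0// => H; rewrite distrC.
have := @main s (r - s); rewrite subrKC; apply => //; last by lra.
have : d <= r / 2 by rewrite /d ge_min lexx.
by lra.
Qed.

Lemma phi_le_ell r : 0 < r -> phi a r <= 10 * ell r `^ a.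
Proof.
move=> r0; rewrite /phi r0 /ell.
set m := Num.min r _.
have m0 : 0 < m by rewrite lt_min r0/= invr_gt0.
have m1 : m <= 10%:R^-1 by rewrite ge_min lexx orbT.
have l10 : ln m <= ln 10%:R^-1 by rewrite ler_ln ?posrE// invr_gt0.
have l1 : 0 < ln 10%:R :> R by rewrite ln_gt0// ltr1n.
have l9 : ln 10%:R <= 9 :> R.
  have := @le_ln1Dx R 9; rewrite (_ : 1 + 9 = 10%:R :> R); last by ring.
  by apply; lra.
rewrite lnV ?posrE// in l10.
have ln0 : ln m < 0 by lra.
rewrite ltr0_norm//.
have g1 := lg_ge1 r0.
have key : - ln m <= 10 * lg r.
  have [r10|r10] := leP 10%:R^-1 r.
    by rewrite /m min_r// lnV ?posrE// opprK; lra.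
  rewrite /m (min_l (ltW r10)).
  have r2 : r <= 2 by have := r10; rewrite (_ : 10^-1 = 10^-1 :> R)//; lra.
  rewrite /lg min_l//.
  have lr : ln r < 0 by rewrite /m min_l ?ltW// in ln0.
  have : - ln r <= - ln r / ln 2.
    rewrite ler_pdivlMr ?ln2_gt0// ler_piMr ?oppr_ge0 ?(ltW lr)//.
    have := @le_ln1Dx R 1; rewrite (_ : 1 + 1 = 2 :> R)//; apply; lra.
  by rewrite mulNr; lra.
have lm : 0 < - ln m by lra.
rewrite powRN.
have -> : (- ln m)^-1 `^ a = ((- ln m) `^ a)^-1.
  by rewrite -powR_inv1 ?ltW// -powRrM mulN1r powRN.
have X0 : 0 < lg r `^ a by rewrite powR_gt0// lg_gt0.
have Y0 : 0 < (- ln m) `^ a by rewrite powR_gt0.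
rewrite ler_pdivlMr// mulrC ler_pdivrMr//.
have g0 := lg_gt0 r0.
apply: (@le_trans _ _ ((10 * lg r) `^ a)).
  by apply: ge0_ler_powR => //; rewrite ?nnegrE ?(ltW a_gt0)//; lra.
rewrite powRM ?(ltW g0)// ler_wpM2r ?(ltW X0)//.
have : 10 `^ a <= 10 `^ 1 :> R by rewrite ler_powR ?ler1n//; move: a_le => ?; lra.
by rewrite powRr1.
Qed.

End log_modulus.

(** * Dini moduli and the integrand of [L_K] *)

Section dini.
Context {R : realType}.
Implicit Types (om : nat -> R).

Lemma bounded_sum_tail om (J tau : R) : (forall i, 0 <= om i) ->
  (forall m, \sum_(i < m) om i <= J) -> 0 < tau ->
  exists I, forall m, \sum_(i < m) (if (I <= i)%N then om i else 0) <= tau.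
Proof.
move=> om0 omJ tau0.
pose T := [set s | exists m, s = \sum_(i < m) om i].
have supT : has_sup T.
  by split; [exists (\sum_(i < 0) om i), 0%N | exists J => s [m ->]].
have [s [I sE] Is] := sup_adherent tau0 supT.
exists I => m.
have H : \sum_(i < m) (if (I <= i)%N then om i else 0) + \sum_(i < I) om i <= sup T.
  apply: (@le_trans _ _ (\sum_(i < I + m) om i)); last first.
    by apply: ub_le_sup; [case: supT|exists (I + m)%N].
  rewrite -(big_mkord xpredT (fun i => if (I <= i)%N then om i else 0)).
  rewrite -!(big_mkord xpredT om) -big_mkcond/= addrC.
  rewrite (big_cat_nat (n := I) (p := (I + m)%N)) ?leq_addr//= lerD2l.
  have [mI|Im] := leqP m I.
    rewrite big_nat_cond big_pred0 ?sumr_ge0// => i.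
    apply/negP => /andP[/andP[_ im] Ii].
    by have := leq_trans (leq_trans im mI) Ii; rewrite ltnn.
  rewrite (big_cat_nat (n := I) (p := m)) ?(ltnW Im)//=.
  rewrite big_nat_cond big_pred0 ?add0r; last first.
    by move=> i; apply/negP => /andP[/andP[_ /leq_trans iI]] /iI; rewrite ltnn.
  rewrite (big_cat_nat (n := m) (p := (I + m)%N)) ?leq_addl ?(ltnW Im)//=.
  rewrite -[leLHS]addr0 lerD ?sumr_ge0//.
  by rewrite big_mkcond; apply: ler_sum => i _; case: ifP.
by rewrite sE in Is; lra.
Qed.

Lemma sum_head_tail om (I m : nat) (e tau : R) : 0 <= e ->
  (forall m, \sum_(i < m) (if (I <= i)%N then om i else 0) <= tau) ->
  \sum_(i < m) (if (I <= i)%N then om i else e) <= tau + I%:R * e.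
Proof.
move=> e0 H.
have -> : \sum_(i < m) (if (I <= i)%N then om i else e) =
    \sum_(i < m) (if (I <= i)%N then om i else 0) +
    \sum_(i < m) (if (I <= i)%N then 0 else e).
  by rewrite -big_split/=; apply: eq_bigr => i _; case: ifP; rewrite ?addr0 ?add0r.
apply: lerD (H m) _.
suff -> : \sum_(i < m) (if (I <= i)%N then 0 else e) = (minn m I)%:R * e.
  by rewrite ler_wpM2r// ler_nat geq_minr.
elim: m => [|m IH]; first by rewrite big_ord0 min0n mul0r.
rewrite big_ord_recr/= IH; case: leqP => mI.
  by rewrite addr0 (minn_idPr (leqW mI)).
by rewrite (minn_idPl mI) -natr1 mulrDl mul1r.
Qed.

(** By monotonicity the integral of [omega r / r] over the dyadic interval from [dya i.+1] to
    [dya i] is at least [omega (dya i.+1) / 2]. *)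
Lemma dini_dyadic_sum (omega : R -> R) : dini_modulus omega ->
  exists J, forall m, \sum_(i < m) omega (dya i) <= J.
Proof.
move=> [om0 [omono omint]].
(* [omega] is monotone on the nonnegative half-line only; cutting the argument at 0 gives a function
   monotone on the whole line, hence measurable. *)
pose g r := omega (Num.max r 0) * r `^ (-1).
have mg : measurable_fun setT g.
  apply: measurable_funM; last exact: measurable_powR.
  apply: nondecreasing_measurable => // r s rs; apply: omono.
  - by rewrite in_itv/= andbT le_max lexx orbT.
  - by rewrite in_itv/= andbT le_max lexx orbT.
  - by rewrite ge_max !le_max rs lexx orbT.
have g0 r : 0 <= g r by rewrite mulr_ge0 ?powR_ge0// om0// le_max lexx orbT.
have gE r : 0 < r -> g r = omega r / r.
  by move=> r0; rewrite /g max_l ?ltW// powR_inv1// ltW.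
pose D := `]0%R, 1%R]%classic : set R.
have intg : (\int[lebesgue_measure]_(r in D) (g r)%:E < +oo)%E.
  apply: le_lt_trans omint; rewrite le_eqVlt; apply/orP; left; apply/eqP.
  apply: eq_integral => r /set_mem rD; congr EFin; apply: gE.
  by rewrite (itvP rD).
have mgD : measurable_fun D (EFin \o g) by apply/measurable_EFinP; exact: measurable_funS mg.
pose B (i : nat) : set R := `]dya i.+1, dya i]%classic.
pose J := fine (\int[lebesgue_measure]_(r in D) (g r)%:E).
have mB i : measurable (B i) by exact: measurable_itv.
have BD i : B i `<=` D.
  move=> r; rewrite /B/D/= !in_itv/= => /andP[r0 r1]; apply/andP; split.
    exact: lt_trans (dya_gt0 _) r0.
  exact: le_trans r1 (dya_le1 _).
have half m : \sum_(i < m) omega (dya i.+1) / 2 <= J.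
  rewrite -lee_fin /J fineK; last first.
    by rewrite ge0_fin_numE//; apply: integral_ge0 => r _; rewrite lee_fin.
  rewrite -(big_mkord xpredT (fun i => omega (dya i.+1) / 2)) -sumEFin.
  apply: (@le_trans _ _ (\int[lebesgue_measure]_(r in
      \big[setU/set0]_(0 <= i < m) B i) (g r)%:E)%E); last first.
    apply: ge0_subset_integral => //.
    - by apply: bigsetU_measurable => i _; exact: measurable_itv.
    - exact: measurable_itv.
    - by move=> r _; rewrite lee_fin.
    - by rewrite -bigcup_seq; apply: bigcup_sub => i _; exact: BD.
  rewrite ge0_integral_bigsetU//; last 4 first.
  - exact: iota_uniq.
  - move=> i j _ _ [r []]; rewrite /B/= !in_itv/= => /andP[i1 i2] /andP[j1 j2].
    apply/eqP; rewrite eqn_leq; apply/andP; split; rewrite leqNgt; apply/negP => ij.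
      by have := lt_le_trans j1 (le_trans i2 (dya_le ij)); rewrite ltxx.
    by have := lt_le_trans i1 (le_trans j2 (dya_le ij)); rewrite ltxx.
  - by apply/measurable_EFinP; exact: measurable_funS mg.
  - by move=> r _; rewrite lee_fin.
  apply: lee_sum => i _.
  apply: (@le_trans _ _ (\int[lebesgue_measure]_(r in B i) (omega (dya i.+1) / dya i)%:E)%E).
    have d0 := dya_gt0 (R := R) i.
    have -> : (\int[lebesgue_measure]_(_ in B i) (omega (dya i.+1) / dya i)%:E =
        (omega (dya i.+1) / dya i)%:E * lebesgue_measure (B i))%E.
      by apply: integral_cst; exact: measurable_itv.
    have -> : lebesgue_measure (B i) = (dya i.+1)%:E.
      rewrite lebesgue_measure_itv/= lte_fin ifT; last by rewrite dyaS; lra.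
      by rewrite -EFinB dyaS; congr EFin; field.
    rewrite -EFinM lee_fin dyaS le_eqVlt; apply/orP; left; apply/eqP.
    by field; rewrite gt_eqF.
  apply: ge0_le_integral => //.
  - exact: measurable_itv.
  - by move=> r _; rewrite lee_fin divr_ge0 ?dya_ge0// om0// dya_ge0.
  - by apply/measurable_EFinP; exact: measurable_funS mg.
  - move=> r; rewrite /B/= in_itv/= => /andP[r0 r1].
    have rp := lt_trans (dya_gt0 _) r0.
    rewrite lee_fin gE//; apply: ler_pM; rewrite ?invr_ge0 ?dya_ge0//.
    - by apply: om0; exact: dya_ge0.
    - by apply: omono; rewrite ?in_itv/= ?andbT ?dya_ge0// ltW.
    - by rewrite lef_pV2 ?posrE ?dya_gt0.
exists (omega (dya 0) + 2 * J) => -[|m].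
  rewrite big_ord0 addr_ge0 ?om0 ?dya_ge0// mulr_ge0//.
  by have := half 0%N; rewrite big_ord0.
rewrite big_ord_recl lerD2l.
by have := half m; rewrite -mulr_suml /bump/=; lra.
Qed.

End dini.

Section kernels.
Context {R : realType}.
Variable n : nat.
Local Notation P := (pt R n.+1).
Local Notation mu := (lebN R n.+1).
Implicit Types (O : set P) (u kap : P -> R).

Definition integrand u kap (y : P) : P -> R :=
  (fun w => (u y - u w) / edist y w ^+ n.+1 * kap w) \_ (oball y 1).

(** The kernel is quantified inside and bounded at every point of the ball: only [lam] and [Lam]
    enter the estimates, so [K x] may be altered on a null set. *)
Definition good u (lam Lam M : R) (y : P) := exists kap : P -> R,
  [/\ forall w, oball y 1 w -> lam <= kap w <= Lam,
      mu.-integrable setT (EFin \o integrand u kap y)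
    & `| \int[mu]_w integrand u kap y w | <= M].

Lemma integrandN u kap y w : integrand (fun z => - u z) kap y w = - integrand u kap y w.
Proof. by rewrite /integrand/= !patchE; case: ifP => _; [ring|rewrite oppr0]. Qed.

Lemma good_opp u lam Lam M y : good u lam Lam M y -> good (fun z => - u z) lam Lam M y.
Proof.
move=> [kap [b ik Mk]]; exists kap; split => //.
  have -> : EFin \o integrand (fun z => - u z) kap y =
      (fun w => (-1)%:E * (integrand u kap y w)%:E)%E.
    by apply/funext => w /=; rewrite integrandN -EFinM mulN1r.
  exact: integrableZl.
have -> : \int[mu]_w integrand (fun z => - u z) kap y w =
    (-1) * \int[mu]_w integrand u kap y w.
  rewrite -RintegralZl//; apply: eq_Rintegral => w _.
  by rewrite integrandN mulN1r.
by rewrite mulN1r normrN.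
Qed.

(** The form in which Dini continuity is used: one sequence [om] serves all centres [y] near [x0],
    so the index [I] can be fixed before the centre is. *)
Definition dini_shells O u := forall x0, O x0 -> exists (r : R) (om : nat -> R),
  [/\ 0 < r, forall i, 0 <= om i,
    forall tau, 0 < tau -> exists I, forall m,
      \sum_(i < m) (if (I <= i)%N then om i else 0) <= tau
  & forall y i w, edist x0 y < r -> dya i < r -> shell y i w -> `|u y - u w| <= om i].

Lemma dini_shells_opp O u : dini_shells O u -> dini_shells O (fun z => - u z).
Proof.
move=> H x0 /H[r [om [r0 om0 T b]]]; exists r, om; split => // y i w ? ? ?.
by rewrite -opprD normrN; exact: b.
Qed.

Lemma dini_loc_shells O u : is_open O -> dini_loc O u -> dini_shells O u.
Proof.
move=> oO dO x0 Ox0; have [r r0 rO] := oO _ Ox0.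
have r2 : 0 < r / 2 by rewrite divr_gt0.
have cO : cball x0 (r / 2) `<=` O.
  by move=> y yr; apply: rO; rewrite /oball/=; move: yr; rewrite /cball/=; lra.
have [omega [dm H]] := dO _ _ r2 cO.
have [J JP] := dini_dyadic_sum dm.
have [om0 [omono _]] := dm.
exists (r / 4), (fun i => omega (dya i)); split.
- by rewrite divr_gt0.
- by move=> i; apply: om0; exact: dya_ge0.
- move=> tau tau0; apply: (@bounded_sum_tail _ (fun i => omega (dya i)) J tau _ JP tau0) => i.
  by apply: om0; exact: dya_ge0.
- move=> y i w yr ir /andP[_ wi].
  have cy : cball x0 (r / 2) y by rewrite /cball/=; lra.
  have cw : cball x0 (r / 2) w.
    by rewrite /cball/=; apply: le_trans (edist_triangle y _ _) _; lra.
  apply: le_trans (H _ _ cy cw) _; apply: omono; last exact: ltW.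
  - by rewrite in_itv/= andbT edist_ge0.
  - by rewrite in_itv/= andbT dya_ge0.
Qed.

Lemma kernel_shell (y w : P) i : shell y i w ->
  (2 ^+ i) ^+ n.+1 <= (edist y w ^+ n.+1)^-1 <= (2 ^+ i.+1) ^+ n.+1.
Proof.
move=> /andP[yi iy]; have y0 := lt_le_trans (dya_gt0 _) yi.
rewrite -!dyaV !exprVn; apply/andP; split.
  by rewrite lef_pV2 ?posrE ?exprn_gt0 ?dya_gt0// lerXn2r ?nnegrE ?ltW ?dya_gt0.
by rewrite lef_pV2 ?posrE ?exprn_gt0 ?dya_gt0// lerXn2r ?nnegrE ?dya_ge0// ltW.
Qed.

Lemma measurable_quotient u kap y : measurable_fun (oball y 1) u ->
  measurable_fun (oball y 1) kap ->
  measurable_fun (oball y 1) (fun w => (u y - u w) / edist y w ^+ n.+1 * kap w).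
Proof.
move=> mu_ mk; apply: measurable_funM => //; apply: measurable_funM.
  by apply: measurable_funB => //; exact: measurable_cst.
apply: (eq_measurable_fun (fun w => (edist y w ^+ n.+1) `^ (-1))).
  by move=> w _; rewrite powR_inv1// exprn_ge0// edist_ge0.
apply: (measurableT_comp (measurable_powR (-1))).
by apply: measurable_funX; apply: measurable_funS (measurable_edist y).
Qed.

(** On the shells beyond [K] the difference of [u] is bounded by the summable Dini sequence, on the
    finitely many others by [2 * b]; [shell_majorant] turns this into an integrable bound. *)
Lemma integrable_integrand O u kap (b Lam : R) y :
  dini_shells O u -> O y -> measurable_fun (oball y 1) u ->
  measurable_fun (oball y 1) kap -> (forall w, oball y 1 w -> 0 <= kap w <= Lam) ->
  (forall w, `|u w| <= b) ->
  mu.-integrable setT (EFin \o integrand u kap y).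
Proof.
move=> dO Oy mu_ mk kb ub.
have [r [om [r0 om0 T H]]] := dO _ Oy.
have [I IP] := T _ ltr01.
have [I' I'r] := dya_small r0.
have b0 : 0 <= b by rewrite (le_trans _ (ub y)).
have L0 : 0 <= Lam.
  have yy : oball y 1 y by rewrite /oball/= edistxx.
  by have /andP[] := kb _ yy; apply: le_trans.
pose K := maxn I I'.
have KP m : \sum_(i < m) (if (K <= i)%N then om i else 0) <= 1.
  apply: le_trans (IP m); apply: ler_sum => i _; rewrite geq_max.
  by case: (leqP I i) => //=; case: ifP.
pose d i := Lam * (if (K <= i)%N then om i else 2 * b).
have d0 i : 0 <= d i by rewrite mulr_ge0//; case: ifP => // _; rewrite mulr_ge0.
have dX m : \sum_(i < m) d i <= Lam * (1 + K%:R * (2 * b)).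
  by rewrite -mulr_sumr ler_wpM2l// sum_head_tail// mulr_ge0.
have [g [ig g0 gd _]] := shell_majorant y d0 dX.
apply: le_integrable ig => //.
- apply/measurable_EFinP; apply/(measurable_restrictT _ (measurable_oball _ _)).
  exact: measurable_quotient.
- move=> w _ /=; rewrite lee_fin [leRHS]ger0_norm//.
  rewrite /integrand patchE; case: ifP; last by rewrite normr0.
  rewrite inE => yw; have [yw0|yw0] := eqVneq (edist y w) 0.
    by rewrite yw0 expr0n/= invr0 mulr0 mul0r normr0.
  have [i wi] : exists i, shell y i w.
    by apply: shell_exists => //; rewrite lt0r yw0 edist_ge0.
  apply: le_trans (gd _ _ wi).
  have /andP[k1 k2] := kernel_shell wi.
  have /andP[kp1 kp2] := kb _ yw.
  have q0 : 0 <= (edist y w ^+ n.+1)^-1 by rewrite invr_ge0 exprn_ge0// edist_ge0.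
  rewrite !normrM (ger0_norm q0) (ger0_norm kp1) mulrAC mulrC.
  rewrite [d i * _]mulrC; apply: ler_pM => //.
    by rewrite mulr_ge0// normr_ge0.
  rewrite /d mulrC; apply: ler_pM => //; case: ifP => Ki.
    apply: H => //; first by rewrite edistxx.
    by apply: le_lt_trans I'r; apply: dya_le; move: Ki; rewrite geq_max => /andP[].
  by apply: le_trans (ler_normB _ _) _; have := ub y; have := ub w; lra.
Qed.

(* [g] dominates the negative part of the integrand near an approximate maximum
   point [y]; adding it leaves every fraction [m] of the kernel available as a gain. *)
Lemma loss_majorant O u (x0 : P) (Lam tau : R) : dini_shells O u -> O x0 ->
  0 < Lam -> 0 < tau ->
  exists e r, [/\ 0 < e, 0 < r & forall (y : P) kap lam (dl : nat -> R) (X : R),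
    edist x0 y < r -> 0 <= lam -> (forall w, oball y 1 w -> lam <= kap w <= Lam) ->
    (forall i, 0 <= dl i) -> (forall m, \sum_(i < m) dl i <= X) ->
    (forall i w, shell y i w -> - (e + dl i) <= u y - u w) ->
    exists g : P -> R, [/\ mu.-integrable setT (EFin \o g), forall w, 0 <= g w,
      forall w m, oball y 1 w -> 0 <= m -> m <= lam * (edist y w ^+ n.+1)^-1 ->
        m * (u y - u w) <= integrand u kap y w + g w
    & \int[mu]_w g w <= 4 ^+ n.+1 * (Lam * (X + tau))]].
Proof.
move=> dO Ox0 L0 tau0.
have [r [om [r0 om0 T H]]] := dO _ Ox0.
have tau2 : 0 < tau / 2 by rewrite divr_gt0.
have [I IP] := T _ tau2.
have [I' I'r] := dya_small r0.
pose K := maxn I I'.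
have KP m : \sum_(i < m) (if (K <= i)%N then om i else 0) <= tau / 2.
  apply: le_trans (IP m); apply: ler_sum => i _; rewrite geq_max.
  by case: (leqP I i) => //=; case: ifP.
(* Only the first [K] shells are charged with [e], which costs at most [tau / 2]; the Dini tail
   costs the other half. *)
pose e := tau / 2 / K.+1%:R.
have e0 : 0 < e by rewrite divr_gt0.
exists e, r; split => // y kap lam dl X yr l0 kb dl0 dlX ul.
pose d' i := (if (K <= i)%N then om i else e) + dl i.
pose d i := Lam * d' i.
have d'0 i : 0 <= d' i by rewrite addr_ge0//; case: ifP => // _; exact: ltW.
have d0 i : 0 <= d i by rewrite mulr_ge0 ?(ltW L0).
have dX m : \sum_(i < m) d i <= Lam * (X + tau).
  rewrite -mulr_sumr ler_wpM2l ?(ltW L0)// big_split/=.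
  apply: le_trans (lerD (@sum_head_tail _ om K m e _ (ltW e0) KP) (dlX m)) _.
  have S3 : K%:R * e <= tau / 2.
    rewrite /e mulrCA ler_piMr ?(ltW tau2)// ler_pdivrMr// mul1r ler_nat; exact: leqnSn.
  by rewrite addrC lerD2l [leRHS](splitr tau) lerD2l.
have [g [ig g0 gd gX]] := shell_majorant y d0 dX.
exists g; split => // w m yw m0 ml.
rewrite /integrand patchE mem_set//.
have [yw0|yw0] := eqVneq (edist y w) 0.
  have -> : m = 0.
    by apply/le_anti; rewrite m0 andbT (le_trans ml)// yw0 expr0n/= invr0 mulr0.
  by rewrite yw0 expr0n/= invr0 mulr0 !mul0r add0r.
have [i wi] : exists i, shell y i w.
  by apply: shell_exists => //; rewrite lt0r yw0 edist_ge0.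
have /andP[k1 k2] := kernel_shell wi.
have /andP[kp1 kp2] := kb _ yw.
have gw := gd _ _ wi.
set q := (edist y w ^+ n.+1)^-1 in ml k1 k2 *.
have q0 : 0 <= q by rewrite invr_ge0 exprn_ge0// edist_ge0.
have da : - d' i <= u y - u w.
  rewrite /d'; case: ifP => Ki; last exact: ul.
  have : `|u y - u w| <= om i.
    apply: H => //.
    by apply: le_lt_trans I'r; apply: dya_le; move: Ki; rewrite geq_max => /andP[].
  by rewrite ler_norml => /andP[H1 _]; have := dl0 i; lra.
move: (u y - u w) da => a da.
have gd' : d' i * (q * kap w) <= g w.
  apply: le_trans gw; rewrite /d [Lam * _]mulrC -mulrA ler_wpM2l// mulrC ler_pM//.
  exact: le_trans l0 kp1.
have mk : m <= q * kap w by apply: (le_trans ml); rewrite mulrC ler_wpM2l.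
(* Raised by [d' i] the difference is nonnegative, so the kernel may be lowered to [m]; the
   correction [q * kap w * d' i] is what [g] pays for. *)
have : m * (a + d' i) <= q * kap w * (a + d' i) by rewrite ler_wpM2r//; lra.
have : 0 <= m * d' i by rewrite mulr_ge0.
by lra.
Qed.

End kernels.

(** * Maximum points and the bound of [sup |u|] *)

Section compactness.
Context {R : realType}.
Variable n : nat.
Local Notation P := (pt R n.+1).

Definition mkvec (f : 'I_n.+1 -> R) : P :=
  mkpt n.+1 (fun i => if insub i is Some j then f j else 0).

Lemma coord_mkvec f (i : 'I_n.+1) : coord (mkvec f) i = f i.
Proof. by rewrite coord_mkpt; case: insubP => [j _ /val_inj -> //|]; rewrite ltn_ord. Qed.

(** The images of the sets [A e] generate a filter on a compact box, and [v] is a cluster point of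
    it. *)
Lemma cluster_row (Q : Type) (m : nat) (c : Q -> 'rV[R]_m) (A : R -> set Q) (b : R) :
  (forall e, 0 < e -> A e !=set0) ->
  (forall e e', e <= e' -> A e `<=` A e') ->
  (forall e q, A e q -> forall i, `|c q 0 i| <= b) ->
  exists v : 'rV[R]_m, forall r e, 0 < r -> 0 < e ->
    exists2 q, A e q & forall i, `|v 0 i - c q 0 i| < r.
Proof.
move=> A0 Amono Ab.
pose F := filter_from [set e : R | 0 < e] (fun e => c @` A e).
have FF : ProperFilter F.
  apply: filter_from_proper; last first.
    by move=> e /= /A0[q Aq]; exists (c q), q.
  apply: filter_from_filter; first by exists 1 => /=.
  move=> e e' /= e0 e'0; exists (Num.min e e'); first by rewrite /= lt_min e0.
  move=> _ [q Aq <-]; split; exists q => //; apply: Amono Aq.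
    by rewrite ge_min lexx.
  by rewrite ge_min lexx orbT.
have cK : compact [set v : 'rV[R]_m | forall i, `[- b, b]%classic (v 0 i)].
  by apply: (@rV_compact R m (fun=> `[- b, b]%classic)) => i; exact: segment_compact.
have FK : F [set v : 'rV[R]_m | forall i, `[- b, b]%classic (v 0 i)].
  exists 1 => //= _ [q Aq <-] i; rewrite /= in_itv/=.
  by rewrite -ler_norml; exact: Ab Aq i.
have [v [_ vF]] := cK F FF FK.
exists v => r e r0 e0.
have [|_ [[q Aq <-] vq]] := vF (c @` A e) (ball v r) _ (nbhsx_ballx v r r0).
  by exists e.
exists q => // i; exact: (vq.2 0 i).
Qed.

(** Both points are written into a single row vector, so that one cluster point yields the two
    limits simultaneously. *)
Lemma cluster_pair (A : R -> P -> P -> Prop) (b : R) :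
  (forall e, 0 < e -> exists x y, A e x y) ->
  (forall e e' x y, e <= e' -> A e x y -> A e' x y) ->
  (forall e x y, A e x y -> forall i : 'I_n.+1, `|coord x i| <= b /\ `|coord y i| <= b) ->
  exists x0 y0, forall r e, 0 < r -> 0 < e ->
    exists x y, [/\ A e x y, edist x0 x < r & edist y0 y < r].
Proof.
move=> A0 Amono Ab.
pose c (q : P * P) : 'rV[R]_(n.+1 + n.+1) :=
  row_mx (\row_j coord q.1 j) (\row_j coord q.2 j).
have [v vP] := @cluster_row (P * P) _ c (fun e => [set q | A e q.1 q.2]) b
  (fun e e0 => let: ex_intro x (ex_intro y Axy) := A0 e e0 in
     ex_intro _ (x, y) Axy)
  (fun e e' ee q Aq => Amono e e' q.1 q.2 ee Aq)
  ltac:(move=> e q /Ab H i; rewrite /c mxE; case: splitP => j _; rewrite mxE; case: (H j); done).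
exists (mkvec (fun j => v 0 (lshift _ j))), (mkvec (fun j => v 0 (rshift _ j))) => r e r0 e0.
have r0' : 0 < r / n.+2%:R by rewrite divr_gt0.
have [[x y] /= Axy H] := vP _ _ r0' e0.
have small (z w : P) : (forall i : 'I_n.+1, `|coord w i - coord z i| < r / n.+2%:R) -> edist z w < r.
  move=> zw; apply: Rspace_box_le_ball => // i ilt; exact: (zw (Ordinal ilt)).
exists x, y; split => //; apply: small => i; rewrite coord_mkvec distrC.
  by have := H (lshift _ i); rewrite /c/= row_mxEl mxE.
by have := H (rshift _ i); rewrite /c/= row_mxEr mxE.
Qed.

(** [F] need not be continuous and the supremum [S] need not be attained; it is only approached near
    [(x0, y0)]. With [D] inside the diagonal this also serves functions of one variable. *)
Lemma near_max_pair (D : P -> P -> Prop) (F : P -> P -> R) (b B : R) (x1 y1 : P) :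
  (forall x y, D x y -> forall i : 'I_n.+1, `|coord x i| <= b /\ `|coord y i| <= b) ->
  (forall x y, D x y -> F x y <= B) -> D x1 y1 ->
  exists S x0 y0, [/\ F x1 y1 <= S, forall x y, D x y -> F x y <= S &
    forall r e, 0 < r -> 0 < e ->
      exists x y, [/\ D x y, S - e < F x y, edist x0 x < r & edist y0 y < r]].
Proof.
move=> Db FB D1.
pose T := [set s | exists x y, D x y /\ s = F x y].
have supT : has_sup T.
  by split; [exists (F x1 y1), x1, y1 | exists B => _ [x [y [Dxy ->]]]; exact: FB].
have le x y : D x y -> F x y <= sup T.
  by move=> Dxy; apply: ub_le_sup; [case: supT | exists x, y].
have [|||x0 [y0 H]] := @cluster_pair (fun e x y => D x y /\ sup T - e < F x y) b.
- move=> e e0; have [_ [x [y [Dxy ->]]] lt] := sup_adherent e0 supT.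
  by exists x, y.
- move=> e e' x y ee [Dxy lt]; split => //; apply: le_lt_trans lt.
  by rewrite lerD2l lerN2.
- by move=> e x y [/Db].
exists (sup T), x0, y0; split => //; first exact: le.
by move=> r e r0 e0; have [x [y [[? ?] ? ?]]] := H r e r0 e0; exists x, y.
Qed.

Definition econt (u : P -> R) : Prop := forall x e, 0 < e ->
  exists2 d, 0 < d & forall y, edist x y < d -> `|u x - u y| < e.

Lemma econt_bounded (O : set P) (u : P -> R) (b : R) : econt u ->
  (forall x, O x -> forall i : 'I_n.+1, `|coord x i| <= b) ->
  exists B, forall x, O x -> u x <= B.
Proof.
move=> cu Ob; apply: contrapT => /forallNP nB.
(* The clause [0 < e] makes the family monotone in [e] in spite of the inverse. *)
have [|||x0 [y0 H]] := @cluster_pair (fun e x y => x = y /\ O x /\ e^-1 < u x /\ 0 < e) b.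
- move=> e e0; have /existsNP[x /not_implyP[Ox /negP]] := nB e^-1.
  by rewrite -ltNge => ux; exists x, x.
- move=> e e' x y ee [-> [Ox [ue e0]]]; have e'0 := lt_le_trans e0 ee.
  by do !split => //; apply: le_lt_trans ue; rewrite lef_pV2.
- by move=> e x y [-> [/Ob H _]] i; split; exact: H.
have [d d0 ud] := cu x0 1 ltr01.
have e0 : 0 < (`|u x0| + 1)^-1 by rewrite invr_gt0 ltr_wpDl.
have [x [y [[_ [_ [ux _]]] xd _]]] := H d _ d0 e0.
rewrite invrK in ux; have := ud x xd; have := ler_norm (u x0).
rewrite ltr_norml => H1 /andP[H2 H3]; lra.
Qed.

(** All that the estimates use of the equation: good points with bound [M] are dense in [O]. The
    notion is stable under [u -> - u], which exchanges the two variables in the doubling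
    argument. *)
Definition admissible (O : set P) (u : P -> R) (lam Lam M : R) : Prop :=
  [/\ econt u, forall x, ~ O x -> u x = 0, dini_shells O u &
     forall x r, O x -> 0 < r ->
       exists y, [/\ O y, edist x y < r & good u lam Lam M y]].

Lemma econt_opp u : econt u -> econt (fun x => - u x).
Proof.
move=> cu x e e0; have [d d0 ud] := cu x e e0; exists d => // y xy.
by rewrite -opprD normrN; exact: ud.
Qed.

Lemma admissible_opp O u lam Lam M :
  admissible O u lam Lam M -> admissible O (fun x => - u x) lam Lam M.
Proof.
move=> [cu u0 du gu]; split.
- exact: econt_opp.
- by move=> x /u0 ->; rewrite oppr0.
- exact: dini_shells_opp.
- move=> x r Ox r0; have [y [Oy xy gy]] := gu x r Ox r0.
  by exists y; split => //; exact: good_opp.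
Qed.

End compactness.

Section sup_bound.
Context {R : realType}.
Variable n : nat.
Local Notation P := (pt R n.+1).
Local Notation mu := (lebN R n.+1).

Lemma RintegralDT (f g : P -> R) : mu.-integrable setT (EFin \o f) ->
  mu.-integrable setT (EFin \o g) ->
  \int[mu]_w (f w + g w) = \int[mu]_w f w + \int[mu]_w g w.
Proof. by move=> fi gi; rewrite RintegralD. Qed.

Lemma integrableDT (f g : P -> R) : mu.-integrable setT (EFin \o f) ->
  mu.-integrable setT (EFin \o g) -> mu.-integrable setT (EFin \o (fun w => f w + g w)).
Proof. by move=> fi gi; exact: (integrableD measurableT fi gi). Qed.

Lemma shift_ball_shell (x : P) j :
  oball (shift0 x (3 / 4 * dya j)) (dya j / 16) `<=` shell x j.
Proof.
move=> w; rewrite /oball/shell/= => wj.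
have d0 := dya_gt0 (R := R) j.
have e1 := @edist_shift0 R n.+1 x (3 / 4 * dya j) (ltn0Sn _).
rewrite ger0_norm in e1; last by lra.
have t1 := edist_triangle (shift0 x (3 / 4 * dya j)) x w.
have t2 := edist_triangle w x (shift0 x (3 / 4 * dya j)).
rewrite (edistC w) in t2; rewrite dyaS; apply/andP; split; lra.
Qed.

(* The barrier is [psi w = exp (q b') - exp (q w_0)]: for [q] large its quadratic gain
   in the first coordinate beats the linear loss uniformly over all kernels. *)
Lemma upper_bound (O : set P) (lam Lam b : R) : 0 < lam -> lam <= Lam -> 0 <= b ->
  (forall x, O x -> forall i : 'I_n.+1, `|coord x i| <= b) ->
  exists2 C1, 0 < C1 & forall u M, 0 < M -> admissible O u lam Lam M ->
    forall x, u x <= C1 * M.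
Proof.
move=> lam0 lamLam b0 Ob.
have Lam0 : 0 < Lam by lra.
have [c cE] : exists c : R, c = ball_const n by exists (ball_const n).
have c0 : 0 < c by rewrite cE; exact: ball_const_gt0.
have [k4 k4E] : exists k4 : R, k4 = 4 ^+ n.+1 by exists (4 ^+ n.+1).
have k40 : 0 < k4 by rewrite k4E exprn_gt0.
(* With [BE] the size of the barrier at the good point, the gain is [lam * c * BE * q ^+ 2 / 8] and
   the loss [2 * k4 * Lam * BE * q]; this [q] leaves a surplus of at least [BE * q]. *)
pose q := 1 + 8 * (2 * k4 * Lam + 1) / (lam * c).
have lc0 : 0 < lam * c by rewrite mulr_gt0.
have kL0 : 0 < k4 * Lam by rewrite mulr_gt0.
have q1 : 1 <= q by rewrite lerDl divr_ge0 ?(ltW lc0)//; lra.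
have lcq : 2 * (k4 * Lam) + 1 <= lam * c * q / 8.
  have -> : lam * c * q = lam * c + 8 * (2 * k4 * Lam + 1).
    by rewrite /q; field; rewrite !gt_eqF.
  by lra.
clearbody q; have q0 : 0 < q by lra.
pose b' := b + 1.
pose Eb := expR (q * b'); have Eb0 : 0 < Eb by exact: expR_gt0.
exists (2 * Eb * Eb); first by rewrite !mulr_gt0.
move=> u M M0 [cu u0 du gu] x1; rewrite leNgt; apply/negP => ux1.
(* Since [Eb * E y >= 1] on [O], this makes [B * E y] at least [2 * M] there. The constant
   [2 * Eb * Eb] of the lemma is [B * Eb / M], so [G x1] is positive. *)
pose B := 2 * M * Eb; have B0 : 0 < B by rewrite !mulr_gt0.
pose E (w : P) := expR (q * coord w 0); have E0 w : 0 < E w by exact: expR_gt0.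
pose G x := u x - B * (Eb - E x).
pose cube (x : P) := forall i : 'I_n.+1, `|coord x i| <= b'.
have Ocube x : O x -> cube x by move=> /Ob H i; apply: le_trans (H i) _; rewrite lerDl.
have EEb x : cube x -> E x <= Eb.
  move=> /(_ ord0) /=; rewrite ler_norml => /andP[_ H].
  by rewrite ler_expR ler_pM2l.
have Ox1 : O x1.
  apply: contrapT => /u0 u1; move: ux1; rewrite u1 ltNge => /negP; apply.
  by rewrite !mulr_ge0// ltW.
have Gx1 : 0 < G x1.
  have : 0 < B * E x1 by rewrite mulr_gt0.
  by rewrite /G mulrBr /B => ?; lra.
have [B' uB'] := econt_bounded cu (fun x (Cx : cube x) => Cx).
have [|||S [x0 [y0 [GS SG near]]]] :=
  @near_max_pair R n (fun x y => x = y /\ cube x) (fun x y => G x) b' B' x1 x1.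
- by move=> x y [-> Cy] i.
- move=> x y [_ Cx]; have := uB' x Cx; have := EEb x Cx.
  rewrite -subr_ge0 => /(mulr_ge0 (ltW B0)); rewrite /G; lra.
- by split => //; exact: Ocube.
have S0 : 0 < S by exact: lt_le_trans GS.
(* Outside [O] the function [u] vanishes and the barrier is nonnegative on the cube, so [G] cannot
   come close to [S > 0] there. *)
have Ox0 : O x0.
  apply: contrapT => /u0 ux0.
  have S2 : 0 < S / 2 by rewrite divr_gt0.
  have [d d0 ud] := cu x0 _ S2.
  have [x [y [[_ Cx] Gx x0x _]]] := near d _ d0 S2.
  have := ud x x0x; rewrite ux0 sub0r normrN ltr_norml => /andP[_ ux].
  have := EEb x Cx; rewrite -subr_ge0 => /(mulr_ge0 (ltW B0)).
  by rewrite /G in Gx; lra.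
pose tau := M / (4 * (k4 * Lam)).
have tau0 : 0 < tau by rewrite divr_gt0 ?mulr_gt0.
have tauE : k4 * Lam * tau = M / 4 by rewrite /tau; field; rewrite !gt_eqF.
have [e1 [r [e10 r0 loss]]] := loss_majorant du Ox0 Lam0 tau0.
pose e := Num.min e1 (M / (4 * (lam * c))).
have e0 : 0 < e by rewrite lt_min e10/= divr_gt0 ?mulr_gt0.
have ee1 : e <= e1 by rewrite ge_min lexx.
have elc : lam * c * e <= M / 4.
  apply: (@le_trans _ _ (lam * c * (M / (4 * (lam * c))))).
    by rewrite ler_wpM2l ?(ltW lc0)// ge_min lexx orbT.
  by rewrite le_eqVlt; apply/orP; left; apply/eqP; field; rewrite !gt_eqF.
have [d d0 Gd] : exists2 d, 0 < d & forall y, edist x0 y < d -> S - e < G y.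
  have e4 : 0 < e / 8 by rewrite divr_gt0.
  have [d1 d10 ud] := cu x0 _ e4.
  have eB : 0 < e / 8 / B by rewrite divr_gt0.
  have /cvgrPdist_lt /(_ _ eB) [d2 /= d20 Ed] : {for coord x0 0, continuous (fun t => expR (q * t))}.
    apply: continuous_comp; last exact: continuous_expR.
    by apply: cvgM; [exact: cvg_cst|exact: cvg_id].
  have Ed' y : edist x0 y < d2 -> `|B * E x0 - B * E y| < e / 8.
    move=> xy; rewrite -mulrBr normrM (gtr0_norm B0) mulrC -ltr_pdivlMr//.
    apply: Ed; rewrite /ball/= distrC; apply: le_lt_trans xy.
    exact: (coord_le_edist x0 y ord0).
  pose d := Num.min d1 d2; have d0 : 0 < d by rewrite lt_min d10.
  have dd1 : d <= d1 by rewrite ge_min lexx.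
  have dd2 : d <= d2 by rewrite ge_min lexx orbT.
  exists d => // y xy.
  have [x [z [[_ Cx] Gx x0x _]]] := near d _ d0 e4.
  have := ud y (lt_le_trans xy dd1); have := ud x (lt_le_trans x0x dd1).
  have := Ed' y (lt_le_trans xy dd2); have := Ed' x (lt_le_trans x0x dd2).
  move: Gx; rewrite /G !mulrBr !ltr_norml; clear => ? /andP[? ?] /andP[? ?] /andP[? ?] /andP[? ?].
  lra.
have rd0 : 0 < Num.min r d by rewrite lt_min r0.
have [y [Oy x0y [kap [kb ik iM]]]] := gu x0 _ Ox0 rd0.
have yr : edist x0 y < r by apply: lt_le_trans x0y _; rewrite ge_min lexx.
have Gy : S - e < G y by apply: Gd; apply: lt_le_trans x0y _; rewrite ge_min lexx orbT.
have cubew w : oball y 1 w -> cube w.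
  move=> yw i; have := coord_le_edist y w i; have := Ob y Oy i.
  have := ler_normD (coord w i - coord y i) (coord y i); rewrite subrK /b'.
  by move: yw; rewrite /oball/=; lra.
have EE w : E w = E y * expR (q * (coord w 0 - coord y 0)).
  by rewrite /E -expRD; congr expR; ring.
pose BE := B * E y; have BE0 : 0 < BE by rewrite mulr_gt0.
have gap w : oball y 1 w ->
    - e + BE * (expR (q * (coord w 0 - coord y 0)) - 1) <= u y - u w.
  move=> yw; have := SG w w (conj erefl (cubew w yw)).
  by move: Gy; rewrite /G /BE (EE w); lra.
have hw (w : P) : `|coord w 0 - coord y 0| <= edist y w by exact: (coord_le_edist y w ord0).
pose dl i := BE * q * dya i.
have [] := loss y kap lam dl (BE * q * 2) yr (ltW lam0) kb.
- by move=> i; rewrite mulr_ge0 ?dya_ge0// mulr_ge0 ?ltW.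
- by move=> m; rewrite -mulr_sumr ler_wpM2l ?sum_dya// mulr_ge0 ?ltW.
- move=> i w /andP[_ wi].
  have yw : oball y 1 w by apply: lt_le_trans wi (dya_le1 _).
  have X1 := expR_ge1Dx (q * (coord w 0 - coord y 0)).
  have X2 := gap w yw.
  have X3 : - (q * dya i) <= expR (q * (coord w 0 - coord y 0)) - 1.
    have := hw w; rewrite ler_norml => /andP[H _].
    have : - dya i <= coord w 0 - coord y 0 by lra.
    by move=> /(ler_wpM2l (ltW q0)); lra.
  by have := ler_wpM2l (ltW BE0) X3; rewrite /dl; lra.
move=> g [ig g0 gain intg].
pose h w := integrand u kap y w + g w.
have ih : mu.-integrable setT (EFin \o h) by exact: integrableDT.
have h0 w : 0 <= h w.
  have [yw|yw] := pselect (oball y 1 w).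
    have := gain w 0 yw (lexx _); rewrite mul0r; apply.
    by rewrite mulr_ge0 ?(ltW lam0)// invr_ge0 exprn_ge0// edist_ge0.
  by rewrite /h /integrand patchE memNset// add0r.
have BEM : 2 * M <= BE.
  have : 1 <= Eb * E y.
    rewrite /Eb /E -expRD -expR0 ler_expR -mulrDr mulr_ge0 ?(ltW q0)//.
    by have := Ob y Oy ord0; rewrite ler_norml /b'/= => /andP[H _]; clear -H; lra.
  rewrite -subr_ge0 => /(mulr_ge0 (ltW M0)); rewrite /BE /B; lra.
have Q2 : BE * q * (2 * (k4 * Lam) + 1) <= BE * q * (lam * c * q / 8).
  by rewrite ler_wpM2l// mulr_ge0// ltW.
have BEq : BE <= BE * q by rewrite ler_peMr// ltW.
have th0 : 0 <= lam * (BE * q ^+ 2 / 8 - e).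
  rewrite mulr_ge0 ?(ltW lam0)// subr_ge0 -(ler_pM2l lc0).
  have : 0 <= BE * q * (k4 * Lam) by rewrite !mulr_ge0// ltW.
  by rewrite expr2; move: elc Q2 BEq BEM M0; clear; lra.
(* One ball in the shell of radius 1 suffices: on it the first coordinate grows by at least [1/2],
   so the exponential exceeds 1 by at least [q ^+ 2 / 8]. *)
have := @gain_integral R n h y (fun j => shift0 y (3 / 4 * dya j)) 0 1 _ ih h0 th0.
rewrite -cE.
have E1 : forall j, (0 <= j < 1)%N -> j = 0%N by case.
have psh : forall j, (0 <= j < 1)%N ->
    oball (shift0 y (3 / 4 * dya j)) (dya j / 16) `<=` shell y j.
  by move=> j _; exact: shift_ball_shell.
move=> /(_ psh) H; have {}H := H _.
have : (1 - 0)%:R * (lam * (BE * q ^+ 2 / 8 - e) * c) <= \int[mu]_w h w.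
  apply: H => j w /E1 -> wj; rewrite expr0 expr1n mulr1.
  have := shift_ball_shell wj; rewrite /shell dya0 => /andP[yw0 yw].
  rewrite dya0 /oball/= mulr1 in wj.
  have h2 : 2^-1 <= coord w 0 - coord y 0.
    have := coord_le_edist (shift0 y (3 / 4)) w ord0.
    rewrite /= coord_shift0// ler_norml => /andP[H1 _]; clear -H1 wj; lra.
  have := gain w lam yw (ltW lam0).
  have y0' : 0 < edist y w by apply: lt_le_trans yw0; exact: dya_gt0.
  have K1 : 1 <= (edist y w ^+ n.+1)^-1.
    by rewrite invf_ge1 ?exprn_gt0// exprn_ile1// ltW.
  rewrite ler_peMr ?(ltW lam0)// => /(_ isT); apply: le_trans.
  rewrite ler_wpM2l ?(ltW lam0)//; apply: le_trans (gap w yw).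
  have qh : q / 2 <= q * (coord w 0 - coord y 0) by rewrite ler_wpM2l// ltW.
  have qh0 : 0 <= q * (coord w 0 - coord y 0).
    by rewrite mulr_ge0 ?(ltW q0)//; clear -h2; lra.
  have X1 := expR_ge1Dxn 1 qh0.
  rewrite (_ : 2`!%:R = 2 :> R) in X1; last by [].
  have X2 : (q / 2) ^+ 2 <= (q * (coord w 0 - coord y 0)) ^+ 2.
    by rewrite lerXn2r// nnegrE// divr_ge0// ltW.
  have X3 : q ^+ 2 / 8 <= expR (q * (coord w 0 - coord y 0)) - 1.
    move: X1 X2; rewrite expr_div_n; lra.
  by have := ler_wpM2l (ltW BE0) X3; lra.
rewrite subn0 mul1r /h RintegralDT//.
have := ler_norm (\int[mu]_w integrand u kap y w).
rewrite -k4E in intg.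
move=> H1 H2.
have H3 : \int[mu]_w integrand u kap y w + \int[mu]_w g w <= M + k4 * (Lam * (BE * q * 2 + tau)).
  by apply: lerD => //; exact: le_trans iM.
have := le_trans H2 H3.
(* The surplus [BE * q] would be at most [M] plus two errors of [M / 4], whereas
   [BE * q >= BE >= 2 * M]. *)
by move: tauE; rewrite expr2; move: elc Q2 BEq BEM M0; clear; lra.
Qed.

Lemma sup_bound (O : set P) (lam Lam b : R) : 0 < lam -> lam <= Lam -> 0 <= b ->
  (forall x, O x -> forall i : 'I_n.+1, `|coord x i| <= b) ->
  exists2 C1, 0 < C1 & forall u M, 0 < M -> admissible O u lam Lam M ->
    forall x, `|u x| <= C1 * M.
Proof.
move=> l0 lL b0 Ob; have [C1 C10 H] := upper_bound l0 lL b0 Ob.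
exists C1 => // u M M0 au x; rewrite ler_norml lerNl; apply/andP; split.
  exact: (H _ M M0 (admissible_opp au)).
exact: H.
Qed.

End sup_bound.

(** * Doubling of variables *)

Section doubling.
Context {R : realType}.
Variable n : nat.
Local Notation P := (pt R n.+1).
Local Notation mu := (lebN R n.+1).

Definition doubled (u : P -> R) (A a : R) (x y : P) : R :=
  u x - u y - A * phi a (edist x y).

Lemma doubled_opp (u : P -> R) (A a : R) (x y : P) :
  doubled (fun z => - u z) A a y x = doubled u A a x y.
Proof. by rewrite /doubled edistC; ring. Qed.

Lemma doubled_continuous (u : P -> R) (A a : R) (x0 y0 : P) (e : R) :
  econt u -> 0 < a -> a <= 2^-1 -> 0 < A ->
  0 < edist x0 y0 -> 0 < e ->
  exists2 d, 0 < d & forall x y, edist x0 x < d -> edist y0 y < d ->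
    `|doubled u A a x0 y0 - doubled u A a x y| < e.
Proof.
move=> cu a0 a2 A0 d0 e0.
have e4 : 0 < e / 4 by rewrite divr_gt0.
have eA : 0 < e / 4 / A by rewrite divr_gt0.
have [d1 d10 H1] := cu x0 _ e4; have [d2 d20 H2] := cu y0 _ e4.
have [d3 d30 H3] := phi_continuous a0 a2 d0 eA.
exists (Num.min d1 (Num.min d2 (d3 / 2))).
  by rewrite !lt_min d10 d20 divr_gt0.
move=> x y; rewrite !lt_min => /andP[x1 /andP[_ x3]] /andP[_ /andP[y2 y3]].
have ux := H1 x x1; have uy := H2 y y2.
have dd : `|edist x0 y0 - edist x y| < d3.
  have t1 := edist_triangle x x0 y0; have t2 := edist_triangle y x y0.
  have t3 := edist_triangle x0 x y; have t4 := edist_triangle y0 x0 y.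
  move: x3 y3; rewrite (edistC y y0) in t2; rewrite (edistC x x0) in t3.
  move: (edist x0 x) (edist y0 y) (edist x0 y0) (edist x y) (edist x y0) (edist x0 y) t1 t2 t3 t4.
  clear => p q r s t v t1 t2 t3 t4 *; rewrite ltr_norml; apply/andP; split; lra.
have up := H3 _ dd.
have {}up : `|A * phi a (edist x0 y0) - A * phi a (edist x y)| < e / 4.
  by rewrite -mulrBr normrM (gtr0_norm A0) mulrC -ltr_pdivlMr.
have aux (p0 p1 q0 q1 s0 s1 : R) : `|p0 - p1| < e / 4 -> `|q0 - q1| < e / 4 ->
    `|s0 - s1| < e / 4 -> `|(p0 - q0 - s0) - (p1 - q1 - s1)| < e.
  rewrite !ltr_norml; move: e0; clear.
  by move=> ? /andP[? ?] /andP[? ?] /andP[? ?]; apply/andP; split; lra.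
exact: aux ux uy up.
Qed.

(** The estimate at one of the two points, the other being frozen. By [doubled_opp] it applies to
    [u] at [x] and to [- u] at [y]; [e] and [r] depend on [x0] but not on the good point chosen
    later. *)
Lemma one_sided (O : set P) u (lam Lam A a S tau : R) (x0 : P) :
  dini_shells O u -> O x0 -> 0 < lam -> lam <= Lam -> 0 < A -> 0 < a -> a <= 2^-1 ->
  0 < tau ->
  exists e r, [/\ 0 < e, 0 < r & forall (x y : P) kap k,
    edist x0 x < r -> (forall w, oball x 1 w -> lam <= kap w <= Lam) ->
    dya k.+1 <= edist x y < dya k ->
    (forall w, oball x 1 w -> doubled u A a w y <= S) -> S - e < doubled u A a x y ->
    exists g : P -> R, [/\ mu.-integrable setT (EFin \o g),
      forall w, 0 <= integrand u kap x w + g w,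
      forall w m, oball x 1 w -> 0 <= m -> m <= lam * (edist x w ^+ n.+1)^-1 ->
        m * (u x - u w) <= integrand u kap x w + g w
    & \int[mu]_w g w <=
      4 ^+ n.+1 * (Lam * (A * (phi a (edist x y) * (2 * a * k%:R + 14)) + tau))]].
Proof.
move=> du Ox0 l0 lL A0 a0 a2 tau0.
have L0 := lt_le_trans l0 lL.
have [e [r [e0 r0 H]]] := loss_majorant du Ox0 L0 tau0.
exists e, r; split => // x y kap k xr kb krk FS Sx.
have [] := H x kap lam (fun i => A * loss a k (edist x y) i)
  (A * (phi a (edist x y) * (2 * a * k%:R + 14))) xr (ltW l0) kb.
- by move=> i; rewrite mulr_ge0 ?(ltW A0)// loss_ge0.
- by move=> m; rewrite -mulr_sumr ler_wpM2l ?(ltW A0)// sum_loss.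
- move=> i w /andP[_ wi].
  have xw : oball x 1 w by apply: lt_le_trans wi (dya_le1 _).
  have tri : edist w y <= edist x y + dya i.
    by have := edist_triangle x w y; rewrite (edistC w x); lra.
  have := phi_loss a0 a2 krk tri; rewrite -(ler_pM2l A0) mulrBr.
  have aux (ux uw uy px pw l : R) : uw - uy - pw <= S -> S - e < ux - uy - px ->
    pw - px <= l -> - (e + l) <= ux - uw by clear => *; lra.
  exact: aux (FS w xw) Sx.
move=> g [ig g0 gain intg]; exists g; split => // w.
have [xw|xw] := pselect (oball x 1 w).
  have := gain w 0 xw (lexx _); rewrite mul0r; apply.
  by rewrite mulr_ge0 ?(ltW l0)// invr_ge0 exprn_ge0// edist_ge0.
by rewrite /integrand patchE memNset// add0r.
Qed.

(** Gain on the left, bound for the operators and losses on the right, at distance [rho] of scale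
    [k]. From [j0] on the shells fit into the exterior ball, and [j < k - 3] means
    [16 * dya k <= dya j], so that [rho] is negligible at scale [j]. An interior and a boundary pair
    both lead to this inequality. *)
Definition balance (lam Lam M A a tau : R) (j0 K0 : nat) := exists k rho,
  [/\ (K0 <= k)%N, dya k.+1 <= rho &
   (k - 3 - j0)%:R * (lam * (2 ^+ n.+1)^-1 * (A * phi a rho) * ball_const n) <=
   2 * M + 2 * (4 ^+ n.+1 * (Lam * (A * (phi a rho * (2 * a * k%:R + 14)) + tau)))].

Lemma doubled_scale (u : P -> R) (A a : R) (x y : P) (S : R) (K0 : nat) :
  0 < A -> (forall x y, S / 2 < doubled u A a x y -> edist x y < dya K0) ->
  0 < S -> S / 2 < doubled u A a x y ->
  exists k, (K0 <= k)%N /\ dya k.+1 <= edist x y < dya k.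
Proof.
move=> A0 HK S0 Sxy.
have d0 : 0 < edist x y.
  apply: edist_gt0 => // xy; move: Sxy; rewrite /doubled xy subrr sub0r.
  have : 0 <= A * phi a (edist y y) by rewrite mulr_ge0 ?(ltW A0)// phi_ge0.
  have aux (p : R) : 0 <= p -> ~ (S / 2 < - p) by move: S0; clear => *; lra.
  by move=> /aux.
have dK := HK _ _ Sxy.
have [k kk] := dya_between d0 (lt_le_trans dK (dya_le1 _)).
exists k; split => //; rewrite leqNgt; apply/negP => kK.
by have /andP[k1 _] := kk; have := lt_le_trans dK (le_trans (dya_le kK) k1); rewrite ltxx.
Qed.

Lemma pair_interior (O Cu : set P) u (lam Lam M A a S tau : R) (x0 y0 : P) (j0 K0 : nat) :
  admissible O u lam Lam M -> O x0 -> O y0 -> 0 < lam -> lam <= Lam -> 0 < A ->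
  0 < a -> a <= 2^-1 -> 0 < tau -> 0 < S -> (0 < j0)%N -> (0 < K0)%N ->
  (forall x w, O x -> oball x 1 w -> Cu w) -> (forall x, O x -> Cu x) ->
  (forall x y, Cu x -> Cu y -> doubled u A a x y <= S) ->
  0 < edist x0 y0 -> S <= doubled u A a x0 y0 ->
  (forall x y, S / 2 < doubled u A a x y -> edist x y < dya K0) ->
  balance lam Lam M A a tau j0 K0.
Proof.
move=> au Ox0 Oy0 l0 lL A0 a0 a2 tau0 S0 j00 K00 OCu OCu' FS d0 SF HK.
have [cu u0 du gu] := au.
have [cu' u0' du' gu'] := admissible_opp au.
have [e1 [r1 [e10 r10 H1]]] := one_sided S du Ox0 l0 lL A0 a0 a2 tau0.
have [e2 [r2 [e20 r20 H2]]] := one_sided S du' Oy0 l0 lL A0 a0 a2 tau0.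
(* The bound [S / 2] keeps the good pair in the range where [HK] forces its distance below
   [dya K0]. *)
pose e := Num.min e1 (Num.min e2 (S / 2)).
have e0 : 0 < e by rewrite !lt_min e10 e20 divr_gt0.
have ee1 : e <= e1 by rewrite ge_min lexx.
have ee2 : e <= e2 by rewrite !ge_min lexx !orbT.
have eeS : e <= S / 2 by rewrite !ge_min lexx !orbT.
have [d d_gt0 Hd] := doubled_continuous cu a0 a2 A0 d0 e0.
have [x [Ox x0x gx]] : exists x, [/\ O x, edist x0 x < Num.min r1 d & good u lam Lam M x].
  by apply: gu => //; rewrite lt_min r10.
have [y [Oy y0y gy]] : exists y, [/\ O y, edist y0 y < Num.min r2 d &
    good (fun z => - u z) lam Lam M y].
  by apply: gu' => //; rewrite lt_min r20.
move: x0x y0y; rewrite !lt_min => /andP[x1 xd] /andP[y2 yd].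
have Fxy : S - e < doubled u A a x y.
  have := Hd _ _ xd yd; rewrite ltr_norml => /andP[_]; rewrite ltrBlDr => H;
  rewrite ltrBlDl; exact: le_lt_trans SF H.
have F2 : S / 2 < doubled u A a x y by apply: le_lt_trans Fxy; move: eeS; clear; lra.
have [k [Kk krk]] := doubled_scale A0 HK S0 F2.
have [kapx [bx ix Mx]] := gx; have [kapy [by_ iy My]] := gy.
have krk' : dya k.+1 <= edist y x < dya k by rewrite edistC.
have [||gX [igX hX gainX intX]] := H1 x y kapx k x1 bx krk.
- by move=> w xw; apply: FS; [exact: OCu xw|exact: OCu'].
- by apply: le_lt_trans Fxy; rewrite lerD2l lerN2.
have [||gY [igY hY gainY intY]] := H2 y x kapy k y2 by_ krk'.
- move=> w yw; rewrite doubled_opp; apply: FS; [exact: OCu'|exact: OCu yw].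
- by rewrite doubled_opp; apply: le_lt_trans Fxy; rewrite lerD2l lerN2.
rewrite edistC in intY.
have /andP[kr rk] := krk.
set rho := edist x y in kr rk krk intX intY Fxy.
exists k, rho; split => //.
pose h w := integrand u kapx x w + gX w + (integrand (fun z => - u z) kapy y w + gY w).
have i1 := integrableDT ix igX; have i2 := integrableDT iy igY.
have ih : mu.-integrable setT (EFin \o h) by exact: integrableDT.
have h0 w : 0 <= h w by rewrite addr_ge0.
have D : A * phi a rho <= u x - u y.
  have aux (p q : R) : S / 2 < p - q -> q <= p by move: S0; clear => *; lra.
  exact: aux F2.
have Y0 : 0 <= A * phi a rho by rewrite mulr_ge0 ?(ltW A0)// phi_ge0.
have V0 : 0 < (2 ^+ n.+1)^-1 :> R by rewrite invr_gt0 exprn_gt0.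
have th0 : 0 <= lam * (2 ^+ n.+1)^-1 * (A * phi a rho).
  by apply: mulr_ge0 => //; apply: mulr_ge0; apply: ltW.
have G := @gain_integral R n h x (fun j => shift0 x (3 / 4 * dya j)) j0 (k - 3) _ ih h0 th0.
have {}G := G (fun j _ => @shift_ball_shell R n x j).
have {}G := G _; apply: le_trans (G _) _.
  move=> j w /andP[jj jk] /shift_ball_shell xw.
  have jk1 : (j.+1 <= k)%N by move: jk; clear; lia.
  have j1 : (1 <= j)%N by apply: leq_trans jj.
  have k1 : (1 <= k)%N by apply: leq_trans Kk.
  have /andP[xw1 xw2] := xw.
  have xB : oball x 1 w by apply: lt_le_trans xw2 (dya_le1 _).
  have dj1 : dya j <= 2^-1 :> R by have := dya_le (R := R) j1; rewrite dyaS dya0 mul1r.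
  have dk1 : dya k <= 2^-1 :> R by have := dya_le (R := R) k1; rewrite dyaS dya0 mul1r.
  have dkj : dya k <= dya j.+1 :> R by exact: dya_le.
  have dkj' : dya k <= dya j :> R by apply: dya_le; exact: ltnW.
  have t1 := edist_triangle x y w; have t2 := edist_triangle y x w.
  rewrite (edistC y x) -/rho in t1; rewrite -/rho in t2.
  have [yB yw0 yw2] : [/\ oball y 1 w, 0 < edist y w & edist y w <= 2 * dya j].
    have aux (p q dj dj' dk r : R) : q <= r + p -> p <= r + q -> dj' <= p -> p < dj ->
        r < dk -> dj <= 2^-1 -> dk <= 2^-1 -> dk <= dj' -> dk <= dj ->
        [/\ q < 1, 0 < q & q <= 2 * dj] by clear => *; split; lra.
    exact: aux t1 t2 xw1 xw2 rk dj1 dk1 dkj dkj'.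
  (* The common part of both kernels: [w] is within [dya j] of [x] but only within [2 * dya j] of
     [y], which costs the factor [2 ^+ n.+1]. *)
  pose m := lam * (2 ^+ n.+1)^-1 * (2 ^+ j) ^+ n.+1.
  have m0 : 0 <= m by rewrite !mulr_ge0 ?(ltW l0) ?(ltW V0)// !exprn_ge0.
  have mx : m <= lam * (edist x w ^+ n.+1)^-1.
    rewrite /m -mulrA ler_wpM2l ?(ltW l0)//.
    have /andP[kk _] := kernel_shell xw; apply: le_trans kk.
    by rewrite ler_piMl ?exprn_ge0 ?exprn_ge0// invf_le1 ?exprn_gt0// exprn_ege1// ler1n.
  have my : m <= lam * (edist y w ^+ n.+1)^-1.
    rewrite /m -mulrA ler_wpM2l ?(ltW l0)//.
    have -> : (2 ^+ n.+1)^-1 * (2 ^+ j) ^+ n.+1 = ((2 * dya j) ^+ n.+1)^-1 :> R.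
      by rewrite -(dyaV j) exprMn invfM exprVn.
    rewrite lef_pV2 ?posrE ?exprn_gt0 ?mulr_gt0 ?dya_gt0//.
    by rewrite lerXn2r// nnegrE ?mulr_ge0 ?dya_ge0 ?edist_ge0.
  have e1' := gainX w m xB m0 mx; have e2' := gainY w m yB m0 my.
  have e3 : m * (A * phi a rho) <= m * (u x - u y) by rewrite ler_wpM2l.
  rewrite /h mulrAC -/m; apply: le_trans e3 _.
  have -> : m * (u x - u y) = m * (u x - u w) + m * (- u y - - u w) by ring.
  exact: lerD.
rewrite /h RintegralDT// [X in X + _ <= _]RintegralDT// [X in _ + X <= _]RintegralDT//.
have n1 := ler_norm (\int[mu]_w integrand u kapx x w).
have n2 := ler_norm (\int[mu]_w integrand (fun z => - u z) kapy y w).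
have aux (p1 p2 q1 q2 B : R) : p1 <= M -> q1 <= M -> p2 <= B -> q2 <= B ->
    p1 + p2 + (q1 + q2) <= 2 * M + 2 * B by clear => *; lra.
by apply: aux intX intY; [exact: le_trans Mx|exact: le_trans My].
Qed.

(** No equation is available at [y1], so only [x] jumps. Its jumps into the exterior ball reach
    points where [u] vanishes, as it does at [y1], and thus gain the whole difference. *)
Lemma pair_boundary (O Cu : set P) u (lam Lam M A a S tau rs : R) (x0 y1 z : P) (j0 K0 : nat) :
  admissible O u lam Lam M -> 0 <= M -> O x0 -> 0 < lam -> lam <= Lam -> 0 < A ->
  0 < a -> a <= 2^-1 -> 0 < tau -> 0 < S ->
  (forall x w, O x -> oball x 1 w -> Cu w) ->
  (forall x y, Cu x -> Cu y -> doubled u A a x y <= S) -> Cu y1 -> ~ O y1 ->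
  0 < rs -> dya j0 <= rs -> edist z y1 = rs -> oball z rs `<=` ~` O ->
  S <= doubled u A a x0 y1 ->
  (forall x y, S / 2 < doubled u A a x y -> edist x y < dya K0) ->
  balance lam Lam M A a tau j0 K0.
Proof.
move=> au M0 Ox0 l0 lL A0 a0 a2 tau0 S0 OCu FS Cy1 nOy1 rs0 j0rs zy1 zO SF HK.
have [cu u0 du gu] := au.
have d0 : 0 < edist x0 y1.
  by apply: edist_gt0 => // E; apply: nOy1; rewrite -E.
have [e1 [r1 [e10 r10 H1]]] := one_sided S du Ox0 l0 lL A0 a0 a2 tau0.
pose e := Num.min e1 (S / 2).
have e0 : 0 < e by rewrite !lt_min e10 divr_gt0.
have ee1 : e <= e1 by rewrite ge_min lexx.
have eeS : e <= S / 2 by rewrite !ge_min lexx !orbT.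
have [d d_gt0 Hd] := doubled_continuous cu a0 a2 A0 d0 e0.
have [x [Ox x0x gx]] : exists x, [/\ O x, edist x0 x < Num.min r1 d & good u lam Lam M x].
  by apply: gu => //; rewrite lt_min r10.
move: x0x; rewrite !lt_min => /andP[x1 xd].
have yd : edist y1 y1 < d by rewrite edistxx.
have Fxy : S - e < doubled u A a x y1.
  have := Hd _ _ xd yd; rewrite ltr_norml => /andP[_]; rewrite ltrBlDr => H;
  rewrite ltrBlDl; exact: le_lt_trans SF H.
have F2 : S / 2 < doubled u A a x y1 by apply: le_lt_trans Fxy; move: eeS; clear; lra.
have [k [Kk krk]] := doubled_scale A0 HK S0 F2.
have [kapx [bx ix Mx]] := gx.
have [||gX [igX hX gainX intX]] := H1 x y1 kapx k x1 bx krk.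
- by move=> w xw; apply: FS => //; exact: OCu xw.
- by apply: le_lt_trans Fxy; rewrite lerD2l lerN2.
have /andP[kr rk] := krk.
set rho := edist x y1 in kr rk krk intX Fxy.
exists k, rho; split => //.
pose h w := integrand u kapx x w + gX w.
have ih : mu.-integrable setT (EFin \o h) by exact: integrableDT.
have h0 w : 0 <= h w by exact: hX.
have D : A * phi a rho <= u x - u y1.
  have aux (p q : R) : S / 2 < p - q -> q <= p by move: S0; clear => *; lra.
  exact: aux F2.
have Y0 : 0 <= A * phi a rho by rewrite mulr_ge0 ?(ltW A0)// phi_ge0.
have V0 : 0 < (2 ^+ n.+1)^-1 :> R by rewrite invr_gt0 exprn_gt0.
have th0 : 0 <= lam * (2 ^+ n.+1)^-1 * (A * phi a rho).
  by apply: mulr_ge0 => //; apply: mulr_ge0; apply: ltW.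
(* The point towards the centre [z] at distance [3 / 4 * dya j] from [y1]: the ball of radius
   [dya j / 16] around it stays in the exterior ball and, as [rho] is negligible, in shell [j] of
   [x]. *)
pose p j := lerp y1 z (3 / 4 * dya j / rs).
have geom j w : (j0 <= j < k - 3)%N -> oball (p j) (dya j / 16) w ->
    shell x j w /\ oball z rs w.
  move=> /andP[jj jk] pw; rewrite /oball/= in pw.
  have dj0 : 0 < dya j :> R by exact: dya_gt0.
  have djr : dya j <= rs by apply: le_trans j0rs; exact: dya_le.
  have t0 : 0 <= 3 / 4 * dya j / rs by rewrite divr_ge0 ?(ltW rs0)// mulr_ge0 ?(ltW dj0).
  have t1 : 3 / 4 * dya j / rs <= 1.
    by rewrite ler_pdivrMr// mul1r; move: djr dj0; clear; lra.
  have q1 : edist y1 (p j) = 3 / 4 * dya j.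
    by rewrite edist_lerpl ger0_norm// (edistC y1 z) zy1 divfK// gt_eqF.
  have q2 : edist (p j) z = rs - 3 / 4 * dya j.
    rewrite edist_lerpr ger0_norm ?subr_ge0// (edistC y1 z) zy1 mulrBl mul1r.
    by rewrite divfK// gt_eqF.
  have dkj : 16 * dya k <= dya j :> R.
    have jk4 : (j.+4 <= k)%N by move: jk; clear; lia.
    have := dya_le (R := R) jk4; rewrite !dyaS; clear; lra.
  split.
    have s1 := edist_triangle y1 x w; rewrite -/rho in s1.
    have s2 := edist_triangle (p j) y1 w.
    have s3 := edist_triangle x y1 w; rewrite (edistC y1 x) -/rho in s3.
    have s4 := edist_triangle w y1 (p j); rewrite (edistC w (p j)) in s4.
    rewrite /shell/= dyaS.
    have aux (xw yp pw' yw dj dk r : R) : yp = 3 / 4 * dj -> pw' < dj / 16 -> r < dk ->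
        16 * dk <= dj -> xw <= r + yw -> yw <= yp + pw' -> yw <= r + xw ->
        yp <= yw + pw' -> 0 < dj -> dj / 2 <= xw < dj.
      by clear => *; apply/andP; split; lra.
    exact: aux q1 pw rk dkj s1 s2 s3 s4 dj0.
  have s5 := edist_triangle (p j) z w; rewrite (edistC z (p j)) in s5.
  have aux (zw pz pw' dj : R) : pz = rs - 3 / 4 * dj -> pw' < dj / 16 ->
    zw <= pz + pw' -> 0 < dj -> zw < rs by clear => *; lra.
  exact: aux q2 pw s5 dj0.
have G := @gain_integral R n h x p j0 (k - 3) _ ih h0 th0.
have {}G := G (fun j jj w pw => (geom j w jj pw).1).
have {}G := G _; apply: le_trans (G _) _.
  move=> j w jj /(geom j w jj) [xw zw].
  have /andP[xw1 xw2] := xw.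
  have xB : oball x 1 w by apply: lt_le_trans xw2 (dya_le1 _).
  pose m := lam * (2 ^+ n.+1)^-1 * (2 ^+ j) ^+ n.+1.
  have m0 : 0 <= m by rewrite !mulr_ge0 ?(ltW l0) ?(ltW V0)// !exprn_ge0.
  have mx : m <= lam * (edist x w ^+ n.+1)^-1.
    rewrite /m -mulrA ler_wpM2l ?(ltW l0)//.
    have /andP[kk _] := kernel_shell xw; apply: le_trans kk.
    by rewrite ler_piMl ?exprn_ge0 ?exprn_ge0// invf_le1 ?exprn_gt0// exprn_ege1// ler1n.
  have e1' := gainX w m xB m0 mx.
  have e3 : m * (A * phi a rho) <= m * (u x - u y1) by rewrite ler_wpM2l.
  rewrite /h mulrAC -/m; apply: le_trans e3 _.
  by move: e1'; rewrite (u0 y1 nOy1) (u0 w (zO w zw)).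
rewrite /h RintegralDT//.
have n1 := ler_norm (\int[mu]_w integrand u kapx x w).
set I2 := _ * (Lam * _) in intX *.
have I20 : 0 <= I2.
  rewrite mulr_ge0 ?exprn_ge0// mulr_ge0//; first exact: le_trans (ltW l0) lL.
  rewrite addr_ge0 ?(ltW tau0)// mulr_ge0 ?(ltW A0)// mulr_ge0 ?phi_ge0//.
  by rewrite addr_ge0// mulr_ge0// mulr_ge0// ltW.
have aux (p1 p2 B : R) : 0 <= B -> p1 <= M -> p2 <= B -> p1 + p2 <= 2 * M + 2 * B.
  by move: M0; clear => *; lra.
by apply: aux I20 _ intX; exact: le_trans Mx.
Qed.

End doubling.

(** * Choice of the constants and the contradiction *)

Section log_estimate.
Context {R : realType}.
Variable n : nat.
Local Notation P := (pt R n.+1).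

(** Let [Y = A * phi a rho]. The terms with [2 * a * c2] and those without [k] each take at most a
    quarter of the gain [k * Y * c1], so half of it is at most [3 * M]. But
    [phi a rho >= 1 / (k + 3)] and [k >= 1] give [k * Y >= A / 4], so that half is at least
    [25 / 8 * M]. *)
Lemma balance_contradiction (lam Lam M A a tau c1 c2 : R) (j0 K0 : nat) :
  0 < c1 -> 0 < c2 -> 0 < M -> 0 < a -> a <= 2^-1 ->
  c1 = lam * (2 ^+ n.+1)^-1 * ball_const n -> c2 = 2 * (4 ^+ n.+1 * Lam) ->
  2 * a * c2 <= c1 / 4 -> (3 + j0%:R) * c1 + 14 * c2 <= c1 * K0%:R / 4 ->
  (0 < K0)%N -> c2 * tau <= M -> 25 * M <= A * c1 ->
  ~ balance n lam Lam M A a tau j0 K0.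
Proof.
move=> c10 c20 M0 a0 a2 c1E c2E ac Kc K00 tc Ac [k [rho [Kk kr]]].
have A0 : 0 < A.
  by rewrite -(pmulr_lgt0 _ c10); apply: lt_le_trans Ac; rewrite mulr_gt0.
have Phi := phi_nat_ge a0 a2 kr.
set p := phi a rho in Phi *.
have p0 : 0 <= p by exact: phi_ge0.
have -> : (k - 3 - j0)%:R * (lam * (2 ^+ n.+1)^-1 * (A * p) * ball_const n) =
    (k - 3 - j0)%:R * (A * p * c1) by rewrite c1E; ring.
have -> : 2 * M + 2 * (4 ^+ n.+1 * (Lam * (A * (p * (2 * a * k%:R + 14)) + tau))) =
    2 * M + (A * p * (k%:R * (2 * a * c2) + 14 * c2) + c2 * tau) by rewrite c2E; ring.
have kj : k%:R - (3 + j0%:R) <= (k - 3 - j0)%:R :> R.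
  by rewrite lerBlDr -!natrD ler_nat; clear; lia.
have Kk' : K0%:R <= k%:R :> R by rewrite ler_nat.
pose Y := A * p; rewrite -/Y.
have Y0 : 0 <= Y by rewrite mulr_ge0// ltW.
have YA : A / 4 <= Y * k%:R.
  rewrite /Y -mulrA ler_wpM2l ?(ltW A0)//.
  apply: (@le_trans _ _ (k.+3%:R^-1 * k%:R)); last by rewrite ler_wpM2r.
  rewrite ler_pdivlMl// ler_pdivrMr// -natrM ler_nat.
  by move: (leq_trans K00 Kk); clear; lia.
have k0 : 0 <= k%:R :> R by [].
move: Y Y0 (k%:R) (K0%:R) (j0%:R) ((k - 3 - j0)%:R) YA k0 kj Kk' Kc.
clear -c10 ac tc Ac M0 => Y Y0 kr Kr jr kk YA k0 kj Kk Kc H.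
have h1 : (kr - (3 + jr)) * (Y * c1) <= kk * (Y * c1).
  by rewrite ler_wpM2r// mulr_ge0// ltW.
have h2 : Y * (kr * (2 * a * c2)) <= Y * (kr * (c1 / 4)).
  by rewrite ler_wpM2l// ler_wpM2l.
have h3 : Y * ((3 + jr) * c1 + 14 * c2) <= Y * (c1 * Kr / 4) by rewrite ler_wpM2l.
have h4 : Y * (c1 * Kr / 4) <= Y * (c1 * kr / 4).
  by rewrite ler_wpM2l// ler_pM2r ?invr_gt0// ler_wpM2l// ltW.
have h5 : A / 4 * c1 <= Y * kr * c1 by rewrite ler_wpM2r// ltW.
lra.
Qed.

Lemma log_estimate (O : set P) (lam Lam b : R) : 0 < lam -> lam <= Lam -> 0 <= b ->
  is_open O -> uniform_exterior_sphere O ->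
  (forall x, O x -> forall i : 'I_n.+1, `|coord x i| <= b) ->
  exists a C, [/\ 0 < a, a <= 2^-1, 0 < C & forall u M, 0 < M ->
    admissible O u lam Lam M ->
    forall x y, (forall i : 'I_n.+1, `|coord x i| <= b + 1) ->
      (forall i : 'I_n.+1, `|coord y i| <= b + 1) ->
      u x - u y <= C * M * phi a (edist x y)].
Proof.
move=> l0 lL b0 oO [rs rs0 ext] Ob.
have L0 : 0 < Lam by exact: lt_le_trans lL.
have [C1 C10 bound] := sup_bound l0 lL b0 Ob.
have [j1 j1rs] := dya_small rs0.
pose j0 := j1.+1.
have j0rs : dya j0 <= rs by apply: le_trans (ltW j1rs); exact: dya_le.
have [c1 c1E] : exists c1, c1 = lam * (2 ^+ n.+1)^-1 * ball_const n by eexists.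
have [c2 c2E] : exists c2, c2 = 2 * (4 ^+ n.+1 * Lam) by eexists.
have c10 : 0 < c1.
  by rewrite c1E mulr_gt0 ?ball_const_gt0// mulr_gt0// invr_gt0 exprn_gt0.
have c20 : 0 < c2 by rewrite c2E mulr_gt0// mulr_gt0// exprn_gt0.
pose a := Num.min 2^-1 (c1 / (8 * c2)).
have a0 : 0 < a by rewrite lt_min invr_gt0 ltr0n divr_gt0// mulr_gt0.
have a2 : a <= 2^-1 by rewrite ge_min lexx.
have ac : 2 * a * c2 <= c1 / 4.
  have : a * (8 * c2) <= c1 by rewrite -ler_pdivlMr ?mulr_gt0// ge_min lexx orbT.
  by clearbody a; lra.
clearbody a.
have [K0 [K00 Kc]] : exists K0 : nat, (0 < K0)%N /\ (3 + j0%:R) * c1 + 14 * c2 <= c1 * K0%:R / 4.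
  pose t := ((3 + j0%:R) * c1 + 14 * c2) * 4 / c1.
  exists (Num.trunc t).+1; split => //.
  have : t <= (Num.trunc t).+1%:R by apply: ltW; rewrite truncnS_gt.
  by rewrite /t ler_pdivrMr// => ?; rewrite ler_pdivlMr// (mulrC c1).
(* The first term rules out pairs at distance at least [dya K0], where [phi] is at least
   [1 / (K0 + 3)] and [u] oscillates by at most [2 * C1 * M]; the second is the condition
   [25 * M <= A * c1]. *)
pose Q := 2 * C1 * K0.+3%:R + 25 / c1.
have Q0 : 0 < Q by rewrite addr_gt0// ?divr_gt0// !mulr_gt0.
exists a, Q; split => // u M M0 au x1 y1 Cx1 Cy1.
have [cu u0 du gu] := au.
pose A := Q * M; have A0 : 0 < A by rewrite mulr_gt0.
have Ac : 25 * M <= A * c1.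
  rewrite /A /Q; have -> : (2 * C1 * K0.+3%:R + 25 / c1) * M * c1 =
    2 * C1 * K0.+3%:R * M * c1 + 25 * M by field; rewrite gt_eqF.
  by rewrite lerDr !mulr_ge0// ltW.
pose Cu (x : P) := forall i : 'I_n.+1, `|coord x i| <= b + 1.
have ub x y : u x - u y <= 2 * C1 * M.
  have := bound u M M0 au x; have := bound u M M0 au y; rewrite !ler_norml.
  have aux (p q t : R) : - t <= q <= t -> - t <= p <= t -> p - q <= 2 * t.
    by clear => /andP[? ?] /andP[? ?]; lra.
  by rewrite -mulrA; exact: aux.
have OCu' x : O x -> Cu x by move=> /Ob H i; apply: le_trans (H i) _; rewrite lerDl.
have OCu x w : O x -> oball x 1 w -> Cu w.
  move=> Ox xw i; have H1 := coord_le_edist x w i; have H2 := Ob x Ox i.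
  have := ler_normD (coord w i - coord x i) (coord x i); rewrite subrK.
  move/le_trans; apply; rewrite addrC; apply: lerD => //.
  by apply: le_trans H1 _; exact: ltW.
rewrite -/A leNgt; apply/negP => F1.
have {}F1 : 0 < doubled u A a x1 y1 by rewrite subr_gt0.
have FB x y : doubled u A a x y <= 2 * C1 * M.
  apply: le_trans (ub x y); rewrite /doubled gerBl mulr_ge0 ?(ltW A0)//.
  exact: phi_ge0.
have [|||S [x0 [y0 [S1 FS near]]]] := @near_max_pair R n (fun x y => Cu x /\ Cu y)
    (doubled u A a) (b + 1) (2 * C1 * M) x1 y1.
- by move=> x y [Cx Cy] i.
- by move=> x y _; exact: FB.
- by [].
have {}FS x y : Cu x -> Cu y -> doubled u A a x y <= S by move=> Cx Cy; exact: FS.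
have S0 : 0 < S by exact: lt_le_trans S1.
have HK x y : S / 2 < doubled u A a x y -> edist x y < dya K0.
  move=> Sxy; rewrite ltNge; apply/negP => Kxy.
  have S2 : 0 < S / 2 by rewrite divr_gt0.
  have := lt_trans S2 Sxy; rewrite /doubled subr_gt0 ltNge => /negP; apply.
  apply: le_trans (ub x y) _.
  have P1 := phi_nat_ge a0 a2 (le_trans (dya_le (leqnSn K0)) Kxy).
  apply: le_trans (ler_wpM2l (ltW A0) P1).
  rewrite ler_pdivlMr// /A /Q.
  have -> : (2 * C1 * K0.+3%:R + 25 / c1) * M = 2 * C1 * M * K0.+3%:R + 25 / c1 * M by ring.
  by rewrite lerDl mulr_ge0// ltW// divr_gt0.
have x0y0 : x0 <> y0.
  move=> E; rewrite -{y0}E in near.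
  have S8 : 0 < S / 8 by rewrite divr_gt0.
  have [d d0 ud] := cu x0 _ S8.
  have [x [y [_ Fxy /ud ux /ud uy]]] := near d _ d0 S8.
  have : 0 <= A * phi a (edist x y) by rewrite mulr_ge0 ?(ltW A0)// phi_ge0.
  move: Fxy ux uy; rewrite /doubled !ltr_norml => H1 /andP[H2 H3] /andP[H4 H5] H6.
  have aux (p q r s : R) : S - S / 8 < p - q - s -> - (S / 8) < r - p -> r - q < S / 8 ->
    0 <= s -> False by move: S0; clear => *; lra.
  exact: aux H1 H2 H5 H6.
have d0 : 0 < edist x0 y0 by exact: edist_gt0.
(* Off the diagonal the doubled function is continuous, so the supremum is attained at
   [(x0, y0)]. *)
have SF : S <= doubled u A a x0 y0.
  rewrite leNgt; apply/negP => SF.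
  have e0 : 0 < (S - doubled u A a x0 y0) / 2 by rewrite divr_gt0// subr_gt0.
  have [d dd Hd] := doubled_continuous cu a0 a2 A0 d0 e0.
  have [x [y [_ Fxy /Hd xd /xd]]] := near d _ dd e0.
  rewrite ltr_norml => /andP[H _].
  have aux (p q : R) : S - (S - p) / 2 < q -> - ((S - p) / 2) < p - q -> False.
    by clear => *; lra.
  exact: aux Fxy H.
pose tau := M / c2.
have tau0 : 0 < tau by rewrite divr_gt0.
have tc : c2 * tau <= M by rewrite mulrC divfK ?gt_eqF.
have nobal := balance_contradiction c10 c20 M0 a0 a2 c1E c2E ac Kc K00 tc Ac.
(* Moving [y] to the boundary keeps the value 0 of [v] and does not increase the distance, so the
   doubled function does not decrease. Stated for [v], to be used for [u] and, with the points
   exchanged, for [- u]. *)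
have boundaryP x y (v : P -> R) : admissible O v lam Lam M -> O x -> ~ O y ->
    (forall x y, Cu x -> Cu y -> doubled v A a x y <= S) ->
    (forall x y, S / 2 < doubled v A a x y -> edist x y < dya K0) ->
    S <= doubled v A a x y -> False.
  move=> av Ox nOy FSv HKv Sv.
  have [_ v0 _ _] := av.
  have [y' [[cy' nOy'] dy']] := open_segment_exit oO Ox nOy.
  have [z [zy' zO]] := ext y' (conj cy' nOy').
  have Cy' : Cu y'.
    have [w [Ow y'w]] := cy' 1 ltr01.
    have wy' : oball w 1 y' by rewrite /oball/= edistC.
    exact (OCu _ _ Ow wy').
  have Sv' : S <= doubled v A a x y'.
    apply: le_trans Sv _; rewrite /doubled (v0 _ nOy) (v0 _ nOy') lerD2l lerN2.
    by apply: (ler_wpM2l (ltW A0)); apply: phi_le dy'.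
  exact (nobal (pair_boundary av (ltW M0) Ox l0 lL A0 a0 a2 tau0 S0 OCu FSv Cy' nOy'
    rs0 j0rs zy' zO Sv' HKv)).
have [Ox0|nOx0] := pselect (O x0); have [Oy0|nOy0] := pselect (O y0).
- exact (nobal (pair_interior au Ox0 Oy0 l0 lL A0 a0 a2 tau0 S0 (ltn0Sn j1 : (0 < j0)%N)
    K00 OCu OCu' FS d0 SF HK)).
- exact (boundaryP x0 y0 u au Ox0 nOy0 FS HK SF).
- apply: (boundaryP y0 x0 (fun z => - u z) (admissible_opp au) Oy0 nOx0).
  + by move=> x y Cx Cy; rewrite doubled_opp; exact: FS.
  + by move=> x y; rewrite doubled_opp edistC; exact: HK.
  + by rewrite doubled_opp.
- move: SF; rewrite /doubled (u0 _ nOx0) (u0 _ nOy0) subrr sub0r.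
  have : 0 <= A * phi a (edist x0 y0) by rewrite mulr_ge0 ?(ltW A0)// phi_ge0.
  have aux (p : R) : 0 <= p -> S <= - p -> False by move: S0; clear => *; lra.
  exact: aux.
Qed.

End log_estimate.

(** * Points where [L_K u] is controlled *)

Section good_points.
Context {R : realType}.
Variable n : nat.
Local Notation P := (pt R n.+1).
Local Notation mu := (lebN R n.+1).
Implicit Types (O : set P) (u : P -> R).

Lemma B1_oball : B1 = oball (mkvec (fun=> 0) : P) 1.
Proof.
apply/seteqP; split => z; rewrite /B1 /oball /edist /= (_ : psub z _ = z)//;
  by apply: Rspace_coord_inj => i ilt;
     have := coord_psub z (mkvec (fun=> 0)) i;
     rewrite (coord_mkvec _ (Ordinal ilt)) subr0.
Qed.

Lemma measurable_kernel_section O (K : P -> P -> R) x : measurable O -> O x ->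
  measurable_fun (O `*` B1) (fun p => K p.1 p.2) ->
  measurable_fun (oball x 1) (fun w => K x (psub w x)).
Proof.
move=> mO Ox mK.
have mB : measurable (B1 : set P) by rewrite B1_oball; exact: measurable_oball.
have mKx : measurable_fun B1 (K x).
  move=> _ Y mY.
  have := measurable_xsection x (mK (measurableX mO mB) Y mY).
  rewrite (_ : xsection _ x = B1 `&` K x @^-1` Y)//.
  apply/seteqP; split => z; rewrite /xsection/= inE/=; first by move=> [[_ ?] ?].
  by move=> [? ?].
apply: (measurable_comp (F := B1) (f := K x) (g := fun w => psub w x)) => //.
- by move=> _ [w xw <-].
- by apply: measurable_funS (measurable_psub x).
Qed.

Lemma ae_section (Z : set (P * P)) : measurable Z -> sf_prod mu mu Z = 0%E ->
  {ae mu, forall x, mu (xsection Z x) = 0%E}.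
Proof.
move=> mZ Z0.
have mf : measurable_fun setT (mu \o xsection Z) by exact: measurable_fun_xsection.
have : (\int[mu]_x `|(mu \o xsection Z) x| = 0)%E.
  by rewrite -Z0; apply: eq_integral => x _; rewrite gee0_abs.
move/(ae_eq_integral_abs _ measurableT mf).
by apply: filterS => x; exact.
Qed.

Lemma ae_point O (Q : P -> Prop) (x : P) (r : R) : is_open O -> O x -> 0 < r ->
  {ae mu, forall y, O y -> Q y} -> exists y, [/\ O y, edist x y < r & Q y].
Proof.
move=> oO Ox r0 [Z [mZ Z0 sZ]].
have [s s0 sO] := oO x Ox.
have t0 : 0 < Num.min r s by rewrite lt_min r0.
apply: contrapT => /forallNP H.
have BZ : oball x (Num.min r s) `<=` Z.
  move=> y xy; have : oball x r y /\ oball x s y.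
    by move: xy; rewrite /oball/= lt_min => /andP[].
  move=> [xr xs]; apply: sZ => /= QY; apply: (H y); split => //; first exact: sO.
  by apply: QY; exact: sO.
have Z0' : mu Z = 0%E := Z0.
have : (mu (oball x (Num.min r s)) <= mu Z)%E.
  by apply: le_measure; rewrite ?inE//; exact: measurable_oball.
rewrite Z0'; apply/negP; rewrite -ltNge; apply: lt_le_trans (mu_oball_ge x t0).
by rewrite lte_fin exprn_gt0// divr_gt0.
Qed.

Lemma Linfty_ae O (f : P -> R) : (Linfty_norm O f < +oo)%E ->
  {ae mu, forall x, O x -> `|f x| <= fine (Linfty_norm O f)}.
Proof.
move=> foo; have f0 : (0 <= Linfty_norm O f)%E by exact: Lnorm_ge0.
have E : Linfty_norm O f = ess_sup mu (abse \o (fun x => (\1_O x * f x)%:E)).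
  by rewrite /Linfty_norm unlock /= mu_gt0.
have := ess_sup_ge mu (abse \o (fun x => (\1_O x * f x)%:E)); rewrite -E.
apply: filterS => x /=; rewrite -[X in (_ <= X)%E -> _]fineK; last by rewrite ge0_fin_numE.
by rewrite lee_fin => H Ox; move: H; rewrite indicE mem_set// mul1r.
Qed.

(** [u] is arbitrary far from [O], hence the extension. Points of the closure outside [O] lie within
    distance 1 of [O], so there [u] already agrees with it. *)
Lemma zero_extension_econt O u : is_open O -> continuous_on (eclosure O) u ->
  (forall x, (B1_of O `\` O) x -> u x = 0) -> econt (u \_ O).
Proof.
move=> oO cu u0 x e e0.
have [cx|] := pselect (eclosure O x); last first.
  move=> /existsNP[d /not_implyP[d0 /forallNP nd]].
  exists d => // y xy.
  have nOx : ~ O x by move=> Ox; apply: (nd x); rewrite edistxx.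
  have nOy : ~ O y by move=> Oy; exact: (nd y).
  by rewrite !patchE !memNset// subrr normr0.
have ux : (u \_ O) x = u x.
  rewrite patchE; case: ifPn => //; rewrite notin_setE => nOx.
  rewrite u0//; split => //; have [y [Oy xy]] := cx 1 ltr01.
  by exists y => //; rewrite /oball/= edistC.
have [d1 d10 H] := cu x cx e e0.
have OC y : O y -> eclosure O y by move=> Oy t t0; exists y; rewrite edistxx.
have [Ox|nOx] := pselect (O x).
  have [r r0 rO] := oO x Ox.
  exists (Num.min d1 r); first by rewrite lt_min d10.
  move=> y; rewrite lt_min => /andP[xy xr]; have Oy := rO y xr.
  by rewrite ux patchE mem_set//; apply: H => //; exact: OC.
exists d1 => // y xy; have [Oy|nOy] := pselect (O y).
  by rewrite ux [X in _ - X]patchE mem_set//; apply: H => //; exact: OC.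
by rewrite !patchE !memNset// subrr normr0.
Qed.

Lemma good_ae (O : set P) (K : P -> P -> R) u (lam Lam B : R) :
  0 < lam -> lam <= Lam -> is_open O -> dini_shells O (u \_ O) ->
  measurable_fun (O `*` B1) (fun p => K p.1 p.2) ->
  {ae sf_prod mu mu, forall p, (O `*` B1) p -> lam <= K p.1 p.2 <= Lam} ->
  measurable_fun (B1_of O) u -> (forall w, `|(u \_ O) w| <= B) ->
  (forall x, (B1_of O `\` O) x -> u x = 0) ->
  (Linfty_norm O (LK K u) < +oo)%E ->
  {ae mu, forall x, O x -> good (u \_ O) lam Lam (fine (Linfty_norm O (LK K u))) x}.
Proof.
move=> l0 lL oO dO mK [Z [mZ Z0 sZ]] mu_ uB u0 Loo.
have mO := is_open_measurable oO.
have mB1 := is_open_measurable (is_open_B1_of (O := O)).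
have := ae_section mZ Z0; have := Linfty_ae Loo.
apply: filterS2 => x LM Zx Ox.
have {}LM := LM Ox.
(* Clamping the kernel between [lam] and [Lam] makes the bounds hold everywhere. For almost every
   [x] it changes [K x] only on a null set, hence not the integral. *)
pose kap w := Num.max lam (Num.min Lam (K x (psub w x))).
have kb w : oball x 1 w -> lam <= kap w <= Lam.
  by move=> _; rewrite /kap le_max lexx/= ge_max lL ge_min lexx.
have mKx := measurable_kernel_section mO Ox mK.
have mk : measurable_fun (oball x 1) kap.
  apply: measurable_maxr; first exact: measurable_cst.
  by apply: measurable_minr => //; exact: measurable_cst.
have xO : oball x 1 `<=` B1_of O by move=> w xw; exists x.
have mux : measurable_fun (oball x 1) u by exact: measurable_funS mu_.
have uE w : oball x 1 w -> (u \_ O) w = u w.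
  move=> xw; rewrite patchE; case: ifPn => //; rewrite notin_setE => nOw.
  by rewrite u0//; split => //; exact: xO.
have xx : oball x 1 x by rewrite /oball/= edistxx.
have mux' : measurable_fun (oball x 1) (u \_ O).
  by apply: (eq_measurable_fun u) => // w; rewrite inE => /uE.
exists kap; split => //.
  apply: (integrable_integrand (Lam := Lam) dO Ox mux' mk _ uB) => w /kb /andP[k1 ->].
  by rewrite (le_trans (ltW l0) k1).
rewrite /integrand -Rintegral_mkcond.
suff <- : LK K u x = \int[mu]_(w in oball x 1)
    (((u \_ O) x - (u \_ O) w) / edist x w ^+ n.+1 * kap w) by [].
rewrite /LK /Rintegral; congr fine; apply: ae_eq_integral.
- exact: measurable_oball.
- by apply/measurable_EFinP; exact: measurable_quotient.
- by apply/measurable_EFinP; exact: measurable_quotient.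
exists ((fun w => psub w x) @^-1` xsection Z x); split.
- rewrite -[X in measurable X]setTI; apply: measurable_psub => //.
  exact: measurable_xsection.
- by apply: null_preimage_psub => //; exact: measurable_xsection.
move=> w /= /not_implyP[xw neq]; rewrite /xsection/= inE; apply: sZ => /= H.
apply: neq; rewrite !uE//; congr EFin; congr (_ * _).
have /andP[H1 H2] := H (conj Ox xw).
by rewrite /kap (min_r H2) (max_r H1).
Qed.

End good_points.

(** * Passage to the logarithmic seminorm *)

Lemma ell_gt0 {R : realType} (r : R) : 0 < r -> 0 < ell r.
Proof.
move=> r0; rewrite invr_gt0 normr_gt0 lt_eqF// ln_lt0// lt_min r0 invr_gt0/=.
by rewrite ltr0n/= gt_min invf_lt1 ?ltr1n ?orbT.
Qed.

Theorem theorem4p16 (R : realType) (N : nat) (Omega : set (pt R N)) (lam Lam : R) :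
  (0 < N)%N -> 0 < lam -> lam <= Lam ->
  is_open Omega -> is_bounded Omega -> uniform_exterior_sphere Omega ->
  exists alpha C : R, [/\ 0 < alpha < 1, 0 < C &
    forall (K : pt R N -> pt R N -> R) (u : pt R N -> R),
      (* K in L^oo(Omega x B_1) with lam <= K <= Lam on Omega x B_1 *)
      measurable_fun (Omega `*` B1) (fun p => K p.1 p.2) ->
      {ae sf_prod (lebN R N) (lebN R N), forall p,
          (Omega `*` B1) p -> lam <= K p.1 p.2 <= Lam} ->
      (* u in L^oo(B_1(Omega)) *)
      measurable_fun (B1_of Omega) u ->
      (Linfty_norm (B1_of Omega) u < +oo)%E ->
      (* u in C(closure Omega) and C^Dini_loc(Omega) *)
      continuous_on (eclosure Omega) u ->
      dini_loc Omega u ->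
      (* u = 0 in B_1(Omega) \ Omega *)
      (forall x, (B1_of Omega `\` Omega) x -> u x = 0) ->
      (* L_K u in L^oo(Omega) *)
      measurable_fun Omega (LK K u) ->
      (Linfty_norm Omega (LK K u) < +oo)%E ->
      Lalpha_space alpha (B1_of Omega) u /\
      (log_holder_semi alpha (B1_of Omega) u
         <= C%:E * Linfty_norm Omega (LK K u))%E].
Proof.
case: N Omega => // n Omega _ l0 lL oO [c [M0 OM]] ext.
pose b := \sum_(i < n.+1) `|coord c i| + `|M0|.
have b0 : 0 <= b by rewrite addr_ge0// sumr_ge0.
have Ob x : Omega x -> forall i : 'I_n.+1, `|coord x i| <= b.
  move=> /OM xM i; have H := coord_le_edist c x i.
  have := ler_normD (coord x i - coord c i) (coord c i); rewrite subrK.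
  move/le_trans; apply; rewrite addrC; apply: lerD.
    by rewrite (bigD1 i)//= lerDl sumr_ge0.
  by apply: le_trans H (le_trans (ltW xM) (ler_norm _)).
have [a [C [a0 a2 C0 H]]] := log_estimate l0 lL b0 oO ext Ob.
exists a, (10 * C); split; [by rewrite a0/=; lra | by rewrite mulr_gt0 |].
move=> K u mK bK mu_ uoo cu du u0 mL Loo.
pose v := u \_ Omega.
pose M := fine (Linfty_norm Omega (LK K u)).
have L0 : (0 <= Linfty_norm Omega (LK K u))%E by exact: Lnorm_ge0.
have ME : Linfty_norm Omega (LK K u) = M%:E by rewrite fineK// ge0_fin_numE.
have M_ge0 : 0 <= M by exact: fine_ge0.
have v0 x : ~ Omega x -> v x = 0 by move=> nOx; rewrite /v patchE memNset.
have vu x : Omega x -> v x = u x by move=> Ox; rewrite /v patchE mem_set.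
have cv : econt v by exact: zero_extension_econt.
have dv : dini_shells Omega v.
  apply: dini_loc_shells => // x0 r r0 xO.
  have [om [dom Hom]] := du x0 r r0 xO; exists om; split => // x y cx cy.
  by rewrite !vu; [exact: Hom| exact: xO | exact: xO].
have [B1 vB1] := econt_bounded cv Ob.
have [B2 vB2] := econt_bounded (econt_opp cv) Ob.
have vB w : `|v w| <= `|B1| + `|B2|.
  have [Ow|nOw] := pselect (Omega w); last by rewrite v0// normr0 addr_ge0.
  rewrite ler_norml lerNl; apply/andP; split.
    by apply: le_trans (vB2 w Ow) _; rewrite (le_trans (ler_norm _))// lerDr.
  by apply: le_trans (vB1 w Ow) _; rewrite (le_trans (ler_norm _))// lerDl.
have gae := good_ae l0 lL oO dv mK bK mu_ vB u0 Loo.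
(* [log_estimate] requires a positive bound, while the norm of [LK K u] may be zero; [eta] is
   removed at the end by letting the error [e] tend to 0. *)
have adm eta : 0 < eta -> admissible Omega v lam Lam (M + eta).
  move=> eta0; split => // x r Ox r0.
  have [y [Oy xy [kap [kb ik iM]]]] := ae_point oO Ox r0 gae.
  exists y; split => //; exists kap; split => //; apply: le_trans iM _.
  by rewrite lerDl ltW.
have vE x : B1_of Omega x -> v x = u x.
  move=> Bx; have [Ox|nOx] := pselect (Omega x); first exact: vu.
  by rewrite v0// u0.
have Bb x : B1_of Omega x -> forall i : 'I_n.+1, `|coord x i| <= b + 1.
  move=> [w Ow wx] i; have H1 := coord_le_edist w x i; have H2 := Ob w Ow i.
  have := ler_normD (coord x i - coord w i) (coord w i); rewrite subrK.
  move/le_trans; apply; rewrite addrC; apply: lerD => //.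
  by apply: le_trans H1 _; exact: ltW.
have main x y : B1_of Omega x -> B1_of Omega y -> u x - u y <= C * M * phi a (edist x y).
  move=> Bx By; apply/ler_addgt0Pr => e e0.
  have p0 : 0 <= phi a (edist x y) by exact: phi_ge0.
  pose eta := e / (C * (phi a (edist x y) + 1)).
  have D0 : 0 < C * (phi a (edist x y) + 1) by rewrite mulr_gt0// ltr_wpDl.
  have eta0 : 0 < eta by rewrite divr_gt0.
  have := H v _ (ltr_wpDl M_ge0 eta0) (adm _ eta0) x y (Bb x Bx) (Bb y By).
  rewrite !vE// => /le_trans; apply.
  have -> : C * (M + eta) * phi a (edist x y) =
    C * M * phi a (edist x y) + eta * (C * phi a (edist x y)) by ring.
  have E : eta * (C * (phi a (edist x y) + 1)) = e by rewrite divfK// gt_eqF.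
  by rewrite lerD2l -[leRHS]E !ler_wpM2l ?lerDl// ltW.
have semi : (log_holder_semi a (B1_of Omega) u <= (10 * C)%:E * Linfty_norm Omega (LK K u))%E.
  apply: ge_ereal_sup => _ [x [y [Bx By xy ->]]].
  rewrite ME -EFinM lee_fin.
  have d0 : 0 < edist x y by exact: edist_gt0.
  rewrite ler_pdivrMr ?powR_gt0 ?ell_gt0//.
  apply: (@le_trans _ _ (C * M * phi a (edist x y))).
    rewrite ler_norml lerNl opprB; apply/andP; split; last exact: main.
    by rewrite edistC; exact: main.
  have -> : 10 * C * M * ell (edist x y) `^ a = C * M * (10 * ell (edist x y) `^ a) by ring.
  by rewrite ler_wpM2l ?phi_le_ell// mulr_ge0// ltW.
split => //; apply: lte_add_pinfty => //; apply: le_lt_trans semi _.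
by rewrite ME -EFinM ltry.
Qed.
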